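(* Let $m,n\geq 1$ be integers, let $\Bbbk$ be a field, let $S=\Bbbk[X_1,\ldots,X_m,Y_1,\ldots,Y_n]$, and let $\lambda$ be any vertex-weighting on the complete bipartite graph $K_{m,n}$ with partite sets $\{X_1,\ldots,X_m\}$ and $\{Y_1,\ldots,Y_n\}$. Then Visscher's construction ${}^\lambda V_{m,n}$ yields a (cellular, minimal) free resolution of $S/\mathcal{E}({}^\lambda K_{m,n})$.
   Context: A vertex-weighting on a graph with vertex set $V$ is a function $\lambda\colon V\to\mathbb{N}=\{1,2,3,\ldots\}$. The edge ideal of the vertex-weighted graph ${}^\lambda K_{m,n}$ is the monomial ideal $\mathcal{E}({}^\lambda K_{m,n})=\langle X_i^{\lambda(X_i)}Y_j^{\lambda(Y_j)}\mid i\in[m],\ j\in[n]\rangle\subseteq S$, where $[m]=\{1,\ldots,m\}$. Visscher's construction. Visscher's cell complex $V_{m,n}$ has as nonempty faces the pairs $(A,B)$ with $\emptyset\neq A\subseteq[m]$ and $\emptyset\neq B\subseteq[n]$; the face $(A,B)$ has dimension $|A|+|B|-2$, so the vertices are the pairs $(i,j)=(\{i\},\{j\})$. The labeled cell complex ${}^\lambda V_{m,n}$ is $V_{m,n}$ with the vertex $(i,j)$ labeled by the monomial $f_{i,j}=X_i^{\lambda(X_i)}Y_j^{\lambda(Y_j)}$, and the face $(A,B)$ labeled by $f_{A,B}=\operatorname{lcm}(f_{a,b}\mid a\in A,\ b\in B)$. The associated chain complex $F$ of finite-rank free $S$-modules has $F_0=S$, and for $d\geq1$ the module $F_d$ is free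 with basis the symbols $[A,B]$ with $\emptyset\neq A\subseteq[m]$, $\emptyset\neq B\subseteq[n]$ and $|A|+|B|=d+1$. For $A=\{a_1<\cdots<a_s\}$ and $B=\{b_1<\cdots<b_t\}$ the differential is given by $\partial([\{a\},\{b\}])=f_{a,b}$ and, if $s+t\geq 3$, $$\partial([A,B])=\sum_{i}(-1)^{i-1}\frac{f_{A,B}}{f_{A\smallsetminus\{a_i\},B}}[A\smallsetminus\{a_i\},B]+\sum_{j}(-1)^{s+j-1}\frac{f_{A,B}}{f_{A,B\smallsetminus\{b_j\}}}[A,B\smallsetminus\{b_j\}],$$ where the first sum is over $i=1,\ldots,s$ if $s\geq2$ and is omitted if $s=1$, and the second sum is over $j=1,\ldots,t$ if $t\geq 2$ and is omitted if $t=1$. ''Yields a (cellular, minimal) resolution of $S/\mathcal{E}({}^\lambda K_{m,n})$'' means: $H_i(F)=0$ for all $i\geq1$ and $H_0(F)\cong S/\mathcal{E}({}^\lambda K_{m,n})$ (resolution); $F$ is the chain complex associated to the labeled regular cell complex ${}^\lambda V_{m,n}$ (cellular); and every entry of the matrices of the differentials lies in the ideal generated by the variables (minimal). *)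

(* Defs.v *)
From HB Require Import structures.
From mathcomp Require Import all_boot all_order all_algebra.
From mathcomp Require Import boolp classical_sets reals topology.
From mathcomp Require Import mpoly.

Set Implicit Arguments.
Unset Strict Implicit.
Unset Printing Implicit Defensive.

Import GRing.Theory.
Import numFieldTopology.Exports.

Local Open Scope ring_scope.

Section ModuleQuotient.
Variables (A : comNzRingType) (M : lmodType A) (N : submodClosed M).

(* submodClosed does not inherit from zmodClosed, which quotients require. *)
Definition submod_pred : {pred M} := N.

Lemma submod_pred_zmod : zmod_closed submod_pred.
Proof. exact: GRing.submod_closedB (submodClosedP N). Qed.

HB.instance Definition _ := GRing.isZmodClosed.Build M submod_pred
  submod_pred_zmod.

Definition quotmod := Quotient.quot submod_pred.
HB.instance Definition _ := GRing.Zmodule.on quotmod.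

Definition quotmod_pi (x : M) : quotmod := \pi_(Quotient.quot submod_pred)%qT x.

Lemma quotmod_piP x y : (quotmod_pi x == quotmod_pi y) = (x - y \in N).
Proof. by rewrite /quotmod_pi -Quotient.idealrBE. Qed.

Definition quotmod_scale (a : A) (q : quotmod) : quotmod :=
  quotmod_pi (a *: repr (q : Quotient.quot submod_pred)).

Lemma quotmod_piK (q : quotmod) : quotmod_pi (repr (q : Quotient.quot submod_pred)) = q.
Proof. exact: reprK. Qed.

Lemma quotmod_piD : {morph quotmod_pi : x y / x + y}.
Proof. by move=> x y; exact: (raddfD (\pi_(Quotient.quot submod_pred)%qT)). Qed.

Lemma quotmod_scaleE a x : quotmod_scale a (quotmod_pi x) = quotmod_pi (a *: x).
Proof.
apply/eqP; rewrite quotmod_piP -scalerBr rpredZ // -quotmod_piP.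
by rewrite quotmod_piK.
Qed.

Lemma quotmod_scaleA a b q :
  quotmod_scale a (quotmod_scale b q) = quotmod_scale (a * b) q.
Proof. by rewrite -[q]quotmod_piK !quotmod_scaleE scalerA. Qed.

Lemma quotmod_scale1 : left_id 1 quotmod_scale.
Proof. by move=> q; rewrite -[q]quotmod_piK quotmod_scaleE scale1r. Qed.

Lemma quotmod_scaleDr : right_distributive quotmod_scale +%R.
Proof.
move=> a p q; rewrite -[p]quotmod_piK -[q]quotmod_piK.
by rewrite -quotmod_piD !quotmod_scaleE -quotmod_piD scalerDr.
Qed.

Lemma quotmod_scaleDl q : {morph quotmod_scale^~ q : a b / a + b}.
Proof.
move=> a b; rewrite -[q]quotmod_piK.
by rewrite !quotmod_scaleE -quotmod_piD scalerDl.
Qed.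

HB.instance Definition _ := GRing.Zmodule_isLmodule.Build A quotmod
  quotmod_scaleA quotmod_scale1 quotmod_scaleDr quotmod_scaleDl.

End ModuleQuotient.

Section Submodules.
Variable A : comNzRingType.

Definition limage (M N : lmodType A) (f : {linear M -> N}) : {pred N} :=
  fun y => `[< exists x, y = f x >].

Lemma limage_submod (M N : lmodType A) (f : {linear M -> N}) :
  submod_closed (limage f).
Proof.
split=> [|a x y]; first by apply/asboolP; exists 0; rewrite linear0.
move=> /asboolP[u ->] /asboolP[v ->]; apply/asboolP.
by exists (a *: u + v); rewrite linearP.
Qed.

HB.instance Definition _ (M N : lmodType A) (f : {linear M -> N}) :=
  GRing.isSubmodClosed.Build A N (limage f) (limage_submod f).

(* For M = A^o this is the ideal generated by the family g. *)
Definition lspan (M : lmodType A) (I : finType) (g : I -> M) : {pred M} :=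
  fun y => `[< exists c : I -> A, y = \sum_i c i *: g i >].

Lemma lspan_submod (M : lmodType A) (I : finType) (g : I -> M) :
  submod_closed (lspan g).
Proof.
split=> [|a x y].
  by apply/asboolP; exists (fun=> 0); rewrite big1 // => i _; rewrite scale0r.
move=> /asboolP[u ->] /asboolP[v ->]; apply/asboolP.
exists (fun i => a * u i + v i); rewrite scaler_sumr -big_split /=.
by apply: eq_bigr => i _; rewrite scalerDl scalerA.
Qed.

HB.instance Definition _ (M : lmodType A) (I : finType) (g : I -> M) :=
  GRing.isSubmodClosed.Build A M (lspan g) (lspan_submod g).

End Submodules.

Section Resolutions.
Variable A : comNzRingType.

(* That two consecutive maps compose to 0 is not a field; it is part of
   [free_resolution] below. *)
Record module_sequence := ModuleSequence {
  term : nat -> lmodType A;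
  bd : forall d, {linear term d.+1 -> term d} }.

Definition finite_free (M : lmodType A) : Prop :=
  exists (I : finType) (phi : {linear {ffun I -> A^o} -> M}), bijective phi.

Definition lmod_iso (M N : lmodType A) : Prop :=
  exists phi : {linear M -> N}, bijective phi.

(* H_0 is the cokernel of term 1 -> term 0, as term 0 is mapped to 0. *)
Definition H0 (F : module_sequence) : lmodType A := quotmod (limage (bd F 0)).

Definition free_resolution (F : module_sequence) (Q : lmodType A) : Prop :=
  [/\ forall d, finite_free (term F d),
      forall d (x : term F d.+1),
        bd F d x = 0 <-> exists y : term F d.+2, x = bd F d.+1 y
    & lmod_iso (H0 F) Q].

End Resolutions.

(* The nonempty cells of a finite cell complex; [cell_face c' c] means that c'
   lies in the closure of c, and allows c' = c. *)
Record cell_data := CellData {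
  cells : finType;
  cell_dim : cells -> nat;
  cell_face : rel cells }.

Section RegularCellComplexes.
Local Open Scope classical_set_scope.

Definition closed_disk (R : realType) (d : nat) : set 'rV[R]_d :=
  [set x : 'rV[R]_d | \sum_i x ord0 i ^+ 2 <= 1].
Definition open_disk (R : realType) (d : nat) : set 'rV[R]_d :=
  [set x : 'rV[R]_d | \sum_i x ord0 i ^+ 2 < 1].
#[global] Arguments closed_disk : clear implicits.
#[global] Arguments open_disk : clear implicits.

(* In the third clause g is inverse to f, as f maps onto the closure of the
   cell; disks are Euclidean and 'rV[R]_d carries the product topology. *)
Definition regular_cell_complex (R : realType) (K : cell_data) : Prop :=
  exists (X : topologicalType) (cell : cells K -> set X),
  [/\ hausdorff_space X,
      \bigcup_c cell c = setT /\ trivIset setT cell,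
      (forall c, exists (f : 'rV[R]_(cell_dim c) -> X) (g : X -> 'rV[R]_(cell_dim c)),
        [/\ {within closed_disk R (cell_dim c), continuous f},
            {within closure (cell c), continuous g},
            {in closed_disk R (cell_dim c), cancel f g},
            f @` closed_disk R (cell_dim c) = closure (cell c)
          & f @` open_disk R (cell_dim c) = cell c]),
      (forall c, closure (cell c) `\` cell c `<=`
                 \bigcup_(c' in [set c' | (cell_dim c' < cell_dim c)%N]) cell c')
    & forall c' c, cell_face c' c <-> cell c' `<=` closure (cell c)].

End RegularCellComplexes.

(* The last two conditions concern the cells between c and a cell c'' of
   codimension 2; in the first of them c'' is the empty cell, and the incidence
   number of a vertex and the empty cell is 1. *)
Definition incidence_function (K : cell_data) (inc : cells K -> cells K -> int)
    : Prop :=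
  [/\ forall c c', inc c c' \in [:: 0; 1; -1],
      forall c c', inc c c' != 0 <-> cell_face c' c /\ cell_dim c = (cell_dim c').+1,
      forall c v w, cell_dim c = 1%N -> cell_dim v = 0%N -> cell_dim w = 0%N ->
        cell_face v c -> cell_face w c -> v != w -> inc c v + inc c w = 0
    & forall c e1 e2 c'', cell_dim c = (cell_dim c'').+2 ->
        cell_dim e1 = (cell_dim c'').+1 -> cell_dim e2 = (cell_dim c'').+1 -> e1 != e2 ->
        cell_face e1 c -> cell_face e2 c -> cell_face c'' e1 -> cell_face c'' e2 ->
        inc c e1 * inc e1 c'' + inc c e2 * inc e2 c'' = 0].

Section CellularComplexes.
Variables (k : fieldType) (N : nat) (K : cell_data).
Local Notation S := {mpoly k[N]}.

Definition dcell (d : nat) := {c : cells K | cell_dim c == d}.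

(* Cells are shifted by one degree: cells of dimension d are the basis of the
   term of degree d + 1, and the term of degree 0 belongs to the empty cell. *)
Definition cell_module (d : nat) : lmodType S :=
  if d is d'.+1 then {ffun dcell d' -> S^o} else S^o.

Variables (lab : cells K -> 'X_{1..N}) (inc : cells K -> cells K -> int).

Definition cell_label (c : cells K) : 'X_{1..N} :=
  \big[@mlcm N/0%MM]_(v | (cell_dim v == 0%N) && cell_face v c) lab v.

(* Labels of faces divide, so the truncated difference of exponents below is
   the exponent of the quotient of the two labels. *)
Definition cellular_bd_fun (d : nat) : cell_module d.+1 -> cell_module d :=
  match d return cell_module d.+1 -> cell_module d with
  | 0 => fun x => \sum_v x v * 'X_[cell_label (val v)]
  | d'.+1 => fun x => [ffun u => \sum_v x v *
      ((inc (val v) (val u))%:~R * 'X_[cell_label (val v) - cell_label (val u)])]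
  end.

Lemma cellular_bd_linear d : linear (@cellular_bd_fun d).
Proof.
case: d => [|d] a x y /=.
  rewrite scaler_sumr -big_split /=; apply: eq_bigr => v _.
  by rewrite !ffunE mulrDl -scalerAl.
apply/ffunP => u; rewrite !ffunE scaler_sumr -big_split /=.
by apply: eq_bigr => v _; rewrite !ffunE mulrDl -scalerAl.
Qed.

HB.instance Definition _ d := GRing.isLinear.Build S (cell_module d.+1)
  (cell_module d) *:%R (@cellular_bd_fun d) (@cellular_bd_linear d).

Definition cellular_bd d : {linear cell_module d.+1 -> cell_module d} :=
  @cellular_bd_fun d.

Definition cell_basis d (u : dcell d) : cell_module d.+1 :=
  [ffun v => (v == u)%:R].

Definition variables_ideal : {pred S} :=
  lspan (fun i : 'I_N => 'X_i : S^o).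

Definition minimal_bd
    (D : forall d, {linear cell_module d.+1 -> cell_module d}) : Prop :=
  (forall u : dcell 0, (D 0%N (cell_basis u) : S) \in variables_ideal) /\
  (forall d (u : dcell d.+1) (v : dcell d),
     ((D d.+1 (cell_basis u) : {ffun dcell d -> S^o}) v : S)
       \in variables_ideal).

End CellularComplexes.

Section Visscher.
Variables (k : fieldType) (m n : nat).
Local Notation S := {mpoly k[m + n]}.

(* A vertex-weighting on K_{m,n} is given on the disjoint union of its partite
   sets; the variables X_i and Y_j are numbered by lshift and rshift. *)
Variable lam : 'I_m + 'I_n -> nat.

Definition edge_generator (e : 'I_m * 'I_n) : S :=
  'X_(lshift n e.1) ^+ lam (inl e.1) * 'X_(rshift m e.2) ^+ lam (inr e.2).

Definition edge_ideal : {pred S^o} :=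
  lspan (fun e => edge_generator e : S^o).
HB.instance Definition _ := GRing.SubmodClosed.on edge_ideal.

Definition vface := {c : {set 'I_m} * {set 'I_n} |
  (c.1 != finset.set0) && (c.2 != finset.set0)}.

Definition visscher_cells : cell_data :=
  @CellData vface
    (fun c => (#|(val c).1| + #|(val c).2| - 2)%N)
    (fun c' c => ((val c').1 \subset (val c).1) &&
                 ((val c').2 \subset (val c).2)).

Definition vertex_label (i : 'I_m) (j : 'I_n) : 'X_{1..m + n} :=
  (U_(lshift n i) *+ lam (inl i) + U_(rshift m j) *+ lam (inr j))%MM.

Definition face_label (c : {set 'I_m} * {set 'I_n}) : 'X_{1..m + n} :=
  \big[@mlcm (m + n)/0%MM]_(a in c.1)
    \big[@mlcm (m + n)/0%MM]_(b in c.2) vertex_label a b.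

Local Notation "'F_' d" := (cell_module k (m + n) visscher_cells d)
  (at level 8, d at level 2).

Definition symbol d (c : {set 'I_m} * {set 'I_n}) : F_ d.+1 :=
  [ffun u : dcell visscher_cells d => (val (val u) == c)%:R].

(* Number of elements of P below x, which is i - 1 if x is the i-th smallest
   element of P. *)
Definition rank_below q (P : {set 'I_q}) (x : 'I_q) : nat :=
  #|[pred y in P | (y < x)%N]|.

Definition symbol_bd d (c : {set 'I_m} * {set 'I_n}) : F_ d :=
  match d return F_ d with
  | 0 => 'X_[face_label c]
  | d'.+1 =>
      \sum_(a in c.1 | (1 < #|c.1|)%N)
        ((-1) ^+ rank_below c.1 a *
           'X_[face_label c - face_label (c.1 :\ a, c.2)%SET])
          *: symbol d' (c.1 :\ a, c.2)%SET
    + \sum_(b in c.2 | (1 < #|c.2|)%N)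
        ((-1) ^+ (#|c.1| + rank_below c.2 b) *
           'X_[face_label c - face_label (c.1, c.2 :\ b)%SET])
          *: symbol d' (c.1, c.2 :\ b)%SET
  end.

Definition visscher_bd_fun d (x : F_ d.+1) : F_ d :=
  \sum_(u : dcell visscher_cells d)
    (x : {ffun dcell visscher_cells d -> S^o}) u *: symbol_bd d (val (val u)).

Lemma visscher_bd_linear d : linear (@visscher_bd_fun d).
Proof.
move=> a x y; rewrite /visscher_bd_fun scaler_sumr -big_split /=.
by apply: eq_bigr => u _; rewrite !ffunE scalerDl scalerA.
Qed.

HB.instance Definition _ d := GRing.isLinear.Build S (F_ d.+1) (F_ d) *:%R
  (@visscher_bd_fun d) (@visscher_bd_linear d).

Definition visscher_bd d : {linear F_ d.+1 -> F_ d} := @visscher_bd_fun d.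

Definition visscher_complex : module_sequence S :=
  @ModuleSequence S (cell_module k (m + n) visscher_cells) visscher_bd.

Definition visscher_vertex_label (v : cells visscher_cells) : 'X_{1..m + n} :=
  face_label (val v).

Definition visscher_cellular (R : realType) : Prop :=
  regular_cell_complex R visscher_cells /\
  exists2 inc : cells visscher_cells -> cells visscher_cells -> int,
    incidence_function inc &
    forall d, visscher_bd d =1 cellular_bd k visscher_vertex_label inc d.

End Visscher.

Arguments edge_ideal k {m n} lam.
Arguments visscher_bd k {m n} lam d.
Arguments visscher_complex k {m n} lam.
Arguments visscher_cellular k {m n} lam R.

(* Main.v *)
From HB Require Import structures.
Require Import Defs.
From mathcomp Require Import all_boot all_order all_algebra.
From mathcomp Require Import reals ring zify.
From mathcomp Require boolp classical_sets functions topology normedtype realfun mpoly.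

(** A face (A, B) is determined by the set A + B of vertices of the complete
    bipartite graph ([joint]); the sets that occur are those meeting both sides
    ([full]).  Write z_l for the power of the l-th variable prescribed by the
    weighting.  The label of C is the product of the z_l over l in C, and the
    sign with which l is removed from C is the Koszul sign of the position of l
    in C, so the differential is the Koszul differential of the z_l with all
    terms outside the full sets discarded.

    Resolution.  Multiplying the coefficient of each symbol by the label of the
    symbol ([chain]) turns the differential into the simplicial one, which has
    coefficients 1 and -1 only ([chain_bd]), and identifies the complex in
    positive degrees with the families of polynomials c(C), for C full, such
    that the label of C divides c(C).  The simplicial differential preserves
    monomials, so exactness can be checked for one monomial mu at a time.  The
    sets C that contribute to mu are those made of vertices l with z_l dividing
    mu, and they form the chain complex of a product of two full simplices.
    Choosing a vertex a of the first and b of the second, coning towards a and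
    then towards b contracts it ([truncated_cone_bd]).  The cones only introduce
    the vertices a and b, whose z_a and z_b divide mu, so divisibility by the
    labels is preserved ([truncated_cone_divides]).  Summing over the choices of
    (a, b) gives [divisible_chain_exact].  In degree 0 the image of the
    differential is generated by the labels of the vertices of the complex,
    which are the generators of the edge ideal.

    Cellularity.  The cell complex is the product of two simplices, cut into the
    sets of points with a given support.  Seen from its barycenter, a closed
    face is the unit ball of a gauge, a maximum of linear forms, and stretching
    each ray by the ratio of this gauge and the Euclidean norm is a homeomorphism
    with the disk ([transversal_chart]).  The Koszul signs are incidence numbers
    since two removals anticommute ([sign_swap]).

    Minimality.  The entry of the differential between C + l and C is z_l up to
    sign, and its exponent is positive. *)

Set Implicit Arguments.
Unset Strict Implicit.
Unset Printing Implicit Defensive.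

Module ProductOfSimplices.
Import boolp classical_sets functions topology normedtype realfun.
Import Order.TTheory GRing.Theory Num.Theory.
Import numFieldNormedType.Exports.
Local Open Scope classical_set_scope.
Local Open Scope ring_scope.

(** * Radial homeomorphisms between gauge balls *)

Section RadialMaps.
Variable R : realType.

Lemma continuous_coord (T : topologicalType) p q (f : T -> 'M[R]_(p, q)) :
  (forall i j, continuous (fun x => f x i j)) -> continuous f.
Proof.
move=> fc x A [P nP PA].
suff : \forall y \near x, forall i j, P i j (f y i j) by apply: filterS => y /PA.
apply: filter_forall => i; apply: filter_forall => j.
exact: (fc i j x _ (nP i j)).
Qed.

Lemma continuous_sum (T : topologicalType) (I : finType) (P : pred I)
    (f : I -> T -> R) :
  (forall i, P i -> continuous (f i)) -> continuous (fun x => \sum_(i | P i) f i x).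
Proof. by move=> fc; apply: continuous_big => //; exact: add_continuous. Qed.

Lemma continuous_bigmax (T : topologicalType) (I : finType) (P : pred I)
    (f : I -> T -> R) :
  (forall i, P i -> continuous (f i)) ->
  continuous (fun x => \big[Num.max/0]_(i | P i) f i x).
Proof.
move=> fc; apply: (continuous_big (U := R)) => // -[x y].
apply: (@continuous_max R (R * R)%type fst snd (x, y)).
  exact: cvg_fst.
exact: cvg_snd.
Qed.

Lemma continuous_mulmxr p q r (M : 'M[R]_(q, r)) :
  continuous (fun z : 'M[R]_(p, q) => z *m M).
Proof.
apply: continuous_coord => i j.
under eq_fun => z do rewrite mxE.
apply: continuous_sum => l _ z.
apply: (@continuousM R _ (fun z : 'M[R]_(p, q) => z i l) (fun=> M l j)).
  exact: coord_continuous.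
exact: cst_continuous.
Qed.

(** The unit balls of gauges are star-shaped about 0, and the last clause bounds them;
    it makes radial maps continuous at 0.  Only nonnegative scalars appear in the third
    clause, as the gauge of a simplex is not symmetric. *)
Definition gauge d (q : 'rV[R]_d -> R) : Prop :=
  [/\ continuous q, forall z, 0 <= q z,
      forall t z, 0 <= t -> q (t *: z) = t * q z
    & forall (z : 'rV_d) i, `|z 0 i| <= q z].

Lemma gauge_norm d (q : 'rV[R]_d -> R) z : gauge q -> `|z| <= q z.
Proof.
move=> [_ q0 _ qz]; rewrite [`|z|]mx_normrE; apply/bigmax_leP; split=> // -[i j] _ /=.
by rewrite (ord1 i).
Qed.

Lemma gauge_eq0 d (q : 'rV[R]_d -> R) z : gauge q -> q z = 0 -> z = 0.
Proof.
by move=> gq qz; apply/eqP; rewrite -normr_le0 -qz gauge_norm.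
Qed.

(** The map that preserves rays from 0 and carries the unit ball of q onto that of q'.
    At 0 the quotient is 0 / 0 = 0, which gives the right value. *)
Definition radial d (q q' : 'rV[R]_d -> R) z := (q z / q' z) *: z.

Lemma gauge_radial d (q q' : 'rV[R]_d -> R) z :
  gauge q -> gauge q' -> q' (radial q q' z) = q z.
Proof.
move=> gq gq'; have [_ q0 qZ _] := gq; have [_ q'0 q'Z _] := gq'.
have [/eqP /(gauge_eq0 gq') ->|nz] := boolP (q' z == 0).
  rewrite /radial scaler0 -(scale0r 0) q'Z // qZ //.
  by rewrite !mul0r.
by rewrite /radial q'Z ?divr_ge0 // -mulrA mulVf // mulr1.
Qed.

Lemma radialK d (q q' : 'rV[R]_d -> R) : gauge q -> gauge q' ->
  cancel (radial q q') (radial q' q).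
Proof.
move=> gq gq' z; rewrite {1}/radial gauge_radial //.
have [_ q0 qZ _] := gq; have [_ q'0 q'Z _] := gq'.
have [/eqP /(gauge_eq0 gq) ->|nz] := boolP (q z == 0).
  by rewrite /radial !scaler0.
have nz' : q' z != 0.
  by apply: contra_neq nz => /(gauge_eq0 gq') ->; rewrite -(scale0r 0) qZ // mul0r.
rewrite /radial qZ ?divr_ge0 // scalerA.
suff -> : q z / (q z / q' z * q z) * (q z / q' z) = 1 by rewrite scale1r.
by field; rewrite nz nz'.
Qed.

(** Away from 0 this is continuity of division.  At 0 the norm of the image of z is at
    most q z, because z / q' z stays in a bounded set. *)
Lemma radial_continuous d (q q' : 'rV[R]_d -> R) :
  gauge q -> gauge q' -> continuous (radial q q').
Proof.
move=> gq gq' z; have [qc q0 qZ _] := gq; have [q'c q'0 q'Z _] := gq'.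
have [z0|nz] := eqVneq z 0; last first.
  apply: (@continuousZ R _ _ (fun z => q z / q' z) id); last exact: cvg_id.
  apply: (@continuousM R _ q (fun z => (q' z)^-1)); first exact: qc.
  apply: continuousV; last exact: q'c.
  by apply: contra_neq nz; exact: gauge_eq0.
rewrite z0.
suff : radial q q' x @[x --> (0 : 'rV[R]_d)] --> (0 : 'rV[R]_d).
  have r0 : radial q q' 0 = 0 by rewrite /radial scaler0.
  by rewrite /continuous_at r0.
apply/(@cvgr0Pnorm_lt R 'rV[R]_d _ (nbhs (0 : 'rV[R]_d))) => e e0.
have /cvgr0Pnorm_lt : q x @[x --> (0 : 'rV[R]_d)] --> 0.
  have q00 : q 0 = 0 by rewrite -(scale0r 0) qZ // mul0r.
  by have := qc 0; rewrite /continuous_at q00.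
move=> /(_ e e0); apply: filterS => x; apply: le_lt_trans.
rewrite normrZ normrM normfV -mulrA ler_piMr //.
rewrite mulrC ger0_norm //.
have [->|nz] := eqVneq (q' x) 0; first by rewrite invr0 mulr0.
by rewrite ler_pdivrMr ?mul1r ?gauge_norm // lt_def nz q'0.
Qed.

Definition euclid d (z : 'rV[R]_d) := Num.sqrt (\sum_i z 0 i ^+ 2).

Lemma euclid_gauge d : gauge (@euclid d).
Proof.
split=> [z|z|t z t0|z i].
- apply: continuous_comp; last exact: sqrt_continuous.
  apply: continuous_sum => i _ {}z.
  rewrite (_ : (fun _ => _) = fun x : 'rV[R]_d => x 0 i * x 0 i); last first.
    by apply/funext => x; rewrite expr2.
  by apply: (@continuousM R _ (fun x : 'rV[R]_d => x 0 i) (fun x : 'rV_d => x 0 i));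
     exact: coord_continuous.
- exact: sqrtr_ge0.
- rewrite /euclid -{2}[t]ger0_norm // -sqrtr_sqr -sqrtrM ?sqr_ge0 // mulr_sumr.
  by congr Num.sqrt; apply: eq_bigr => i _; rewrite mxE exprMn.
- rewrite -sqrtr_sqr ler_sqrt ?sumr_ge0 //; last by move=> *; rewrite sqr_ge0.
  rewrite (bigD1 i) //= lerDl sumr_ge0 // => *; exact: sqr_ge0.
Qed.

Lemma closed_diskE d (z : 'rV[R]_d) : closed_disk R d z <-> euclid z <= 1.
Proof.
by rewrite /closed_disk /= /euclid -(ler_sqrt _ ler01) sqrtr1.
Qed.

Lemma open_diskE d (z : 'rV[R]_d) : open_disk R d z <-> euclid z < 1.
Proof.
by rewrite /open_disk /= /euclid -(ltr_sqrt _ ltr01) sqrtr1.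
Qed.

End RadialMaps.

(** * Products of simplices as regular cell complexes *)

Section SimplexProduct.
Variables (R : realType) (N : nat) (J : finType) (side : 'I_N -> J).
Implicit Types (x w : 'rV[R]_N) (C : {set 'I_N}).

(** One coordinate simplex for each s in J, spanned by the basis vectors of the indices
    on side s; the ambient space is the direct sum of the coordinate spaces. *)
Definition simplex_product : set 'rV[R]_N :=
  [set x | (forall l, 0 <= x 0 l) /\ forall s, \sum_(l | side l == s) x 0 l = 1].

Definition supp x : {set 'I_N} := finset.finset (fun l => 0 < x 0 l).

Definition transversal C := [forall s, [exists l in C, side l == s]].

Lemma supp_transversal x : simplex_product x -> transversal (supp x).
Proof.
move=> [x0 x1]; apply/forallP => s; apply/contraT => /exists_inPn h.
have /eqP := x1 s; rewrite big1 ?(eq_sym 0) ?oner_eq0 // => l ls.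
apply/eqP; rewrite eq_le x0 andbT leNgt; apply/negP => xl.
by have := h l; rewrite inE xl ls => /(_ isT).
Qed.

Lemma transversal_section C :
  transversal C -> exists t : J -> 'I_N, forall s, t s \in C /\ side (t s) = s.
Proof.
move=> /forallP tC; apply: (@fin_all_exists J (fun=> 'I_N)
  (fun s l => l \in C /\ side l = s)) => s.
by have /exists_inP [l lC /eqP ls] := tC s; exists l.
Qed.

Lemma transversal_card C : transversal C -> (#|J| <= #|C|)%N.
Proof.
move=> /transversal_section [t tP]; rewrite -(card_codom (f := t)).
  by apply/subset_leq_card/fintype.subsetP => _ /codomP[s ->]; have [] := tP s.
by apply: (can_inj (g := side)) => s; have [] := tP s.
Qed.

Definition barycenter C : 'rV[R]_N :=
  \row_l (if l \in C then #|[pred l' in C | side l' == side l]|%:R^-1 else 0).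

Definition tangent C w :=
  (forall l, l \notin C -> w 0 l = 0) /\ forall s, \sum_(l | side l == s) w 0 l = 0.

Lemma tangentB C w w' : tangent C w -> tangent C w' -> tangent C (w - w').
Proof.
move=> [w0 ws] [w0' ws']; split=> [l lC|s]; first by rewrite !mxE w0 // w0' // subr0.
by under eq_bigr => l _ do rewrite !mxE; rewrite sumrB ws ws' subr0.
Qed.

Lemma barycenter_gt0 C l : l \in C -> 0 < barycenter C 0 l.
Proof.
move=> lC; rewrite mxE lC invr_gt0 ltr0n; apply/card_gt0P; exists l.
by rewrite inE lC eqxx.
Qed.

Lemma barycenter_ge0 C l : 0 <= barycenter C 0 l.
Proof.
have [/barycenter_gt0/ltW //|lC] := boolP (l \in C).
by rewrite mxE (negbTE lC).
Qed.

Lemma barycenter_out C l : l \notin C -> barycenter C 0 l = 0.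
Proof. by move=> lC; rewrite mxE (negbTE lC). Qed.

Lemma barycenter_sum C s : transversal C ->
  \sum_(l | side l == s) barycenter C 0 l = 1.
Proof.
move=> /forallP /(_ s) /exists_inP [l0 l0C l0s].
rewrite (bigID (fun l => l \in C)) /= [X in _ + X]big1 ?addr0; last first.
  by move=> l /andP[_ lC]; rewrite barycenter_out.
pose n := #|[pred l in C | side l == s]|.
rewrite (eq_bigr (fun=> n%:R^-1)).
  rewrite sumr_const (_ : #|_| = n); last by apply: eq_card => l; rewrite !inE andbC.
  rewrite -[LHS]mulr_natl mulfV // pnatr_eq0 -lt0n; apply/card_gt0P; exists l0.
  by rewrite inE l0C.
by move=> l /andP[/eqP ls lC]; rewrite mxE lC ls.
Qed.

Lemma supp_barycenter C : supp (barycenter C) = C.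
Proof.
apply/setP => l; rewrite inE; have [lC|lC] := boolP (l \in C).
  by rewrite barycenter_gt0.
by rewrite barycenter_out // ltxx.
Qed.

Lemma barycenter_simplex C : transversal C -> simplex_product (barycenter C).
Proof.
by move=> tC; split=> [l|s]; [exact: barycenter_ge0|exact: barycenter_sum].
Qed.

Lemma barycenter_le1 C l : transversal C -> barycenter C 0 l <= 1.
Proof.
move=> tC; rewrite -(barycenter_sum (side l) tC) (bigD1 l) //= lerDl.
by apply: sumr_ge0 => ? _; exact: barycenter_ge0.
Qed.

(** A point [barycenter C + w], with w tangent, has nonnegative coordinates iff this
    gauge is at most 1 at w, and positive coordinates on C iff it is less than 1. *)
Definition face_gauge C w := \big[Num.max/0]_(l in C) (- w 0 l / barycenter C 0 l).

Lemma face_gauge_ge0 C w : 0 <= face_gauge C w.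
Proof. exact: bigmax_ge_id. Qed.

Lemma face_gaugeP C w l : l \in C -> - w 0 l <= face_gauge C w * barycenter C 0 l.
Proof.
move=> lC; rewrite -ler_pdivrMr ?barycenter_gt0 //.
by apply: (le_bigmax_cond _ (fun l => - w 0 l / barycenter C 0 l)).
Qed.

(** The gauge bounds the negative parts of the coordinates of w; the positive parts are
    bounded because the coordinates on each side add up to 0. *)
Lemma face_gauge_tangent C w l : transversal C -> tangent C w ->
  `|w 0 l| <= face_gauge C w.
Proof.
move=> tC [w0 ws]; have q0 := face_gauge_ge0 C w.
have wb l' : - w 0 l' <= face_gauge C w * barycenter C 0 l'.
  have [|lC] := boolP (l' \in C); first exact: face_gaugeP.
  by rewrite w0 // barycenter_out // mulr0 oppr0.
rewrite ler_norml lerNl (le_trans (wb l)) /=; last first.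
  by rewrite ler_piMr // barycenter_le1.
have /eqP := ws (side l); rewrite (bigD1 l) //= addr_eq0 => /eqP ->.
rewrite -sumrN; apply: le_trans (ler_sum _ (fun l' _ => wb l')) _.
rewrite -mulr_sumr ler_piMr // -(barycenter_sum (side l) tC) [leRHS](bigD1 l) //=.
by rewrite lerDr barycenter_ge0.
Qed.

Lemma tangent_barycenter C x : transversal C -> simplex_product x ->
  supp x \subset C -> tangent C (x - barycenter C).
Proof.
move=> tC [x0 x1] /fintype.subsetP sx; split=> [l lC|s].
  rewrite mxE [X in _ + X]mxE barycenter_out // subr0.
  apply/eqP; rewrite eq_le x0 andbT leNgt; apply: contra lC => xl.
  by apply: sx; rewrite inE.
under eq_bigr => l _ do rewrite mxE [X in _ + X]mxE.
by rewrite sumrB x1 barycenter_sum // subrr.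
Qed.

Lemma face_gauge_le1 C w : transversal C -> tangent C w ->
  face_gauge C w <= 1 <->
  simplex_product (barycenter C + w) /\ supp (barycenter C + w) \subset C.
Proof.
move=> tC [w0 ws]; split=> [q1|[[x0 _] _]].
  split; [split|] => [l|s|].
  - rewrite mxE; have [lC|lC] := boolP (l \in C).
      rewrite -lerBlDr sub0r (le_trans (face_gaugeP w lC)) //.
      by rewrite ler_piMl // barycenter_ge0.
    by rewrite w0 // addr0 barycenter_ge0.
  - under eq_bigr => l _ do rewrite mxE.
    by rewrite big_split /= ws barycenter_sum // addr0.
  - apply/fintype.subsetP => l; rewrite inE mxE; apply: contraLR => lC.
    by rewrite w0 // barycenter_out // addr0 ltxx.
apply/bigmax_leP; split=> // l lC; rewrite ler_pdivrMr ?barycenter_gt0 // mul1r.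
by rewrite lerNl -subr_ge0 opprK addrC; have := x0 l; rewrite mxE.
Qed.

Lemma face_gauge_lt1 C w : transversal C -> tangent C w ->
  face_gauge C w < 1 <->
  simplex_product (barycenter C + w) /\ supp (barycenter C + w) = C.
Proof.
move=> tC tw; have [w0 ws] := tw; split=> [q1|[_ sx]].
  have [px sx] : simplex_product (barycenter C + w) /\ supp (barycenter C + w) \subset C.
    by apply/face_gauge_le1 => //; exact: ltW.
  split=> //; apply/eqP; rewrite finset.eqEsubset sx; apply/fintype.subsetP => l lC.
  rewrite inE mxE -ltrBlDr sub0r (le_lt_trans (face_gaugeP w lC)) //.
  by rewrite gtr_pMl // barycenter_gt0.
apply/bigmax_ltP; split=> // l lC; rewrite ltr_pdivrMr ?barycenter_gt0 // mul1r.
rewrite ltrNl -subr_gt0 opprK addrC; move: lC; rewrite -{1}sx inE mxE //.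
Qed.

Section Chart.
Variables (C : {set 'I_N}) (d : nat) (t : J -> 'I_N) (e : 'I_d -> 'I_N).
Hypotheses (tC : forall s, t s \in C) (tside : forall s, side (t s) = s).
Hypotheses (eC : forall i, e i \in C) (e_inj : injective e).
Hypotheses (et : forall i s, e i != t s)
  (cover : forall l, l \in C -> l = t (side l) \/ exists i, l = e i).

Let C_transversal : transversal C.
Proof. by apply/forallP => s; apply/exists_inP; exists (t s); rewrite ?tside. Qed.

(** Row i is the tangent vector that moves mass from the base point t of its side to e i. *)
Definition chart_mx : 'M[R]_(d, N) :=
  \matrix_(i, l) ((l == e i)%:R - (l == t (side (e i)))%:R).

Definition coords w : 'rV[R]_d := \row_i w 0 (e i).

Lemma coordsB w w' : coords (w - w') = coords w - coords w'.
Proof. by apply/rowP => i; rewrite !mxE. Qed.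

Lemma coordsK z : coords (z *m chart_mx) = z.
Proof.
apply/rowP => i; rewrite !mxE (bigD1 i) //= big1 ?addr0 => [|i' ii'].
  by rewrite mxE eqxx (negbTE (et _ _)) subr0 mulr1.
by rewrite mxE (inj_eq e_inj) eq_sym (negbTE ii') (negbTE (et _ _)) subr0 mulr0.
Qed.

Lemma chart_tangent z : tangent C (z *m chart_mx).
Proof.
have sum1 s a : \sum_(l | side l == s) (l == a)%:R = (side a == s)%:R :> R.
  rewrite big_mkcond /= (bigD1 a) //= eqxx big1 ?addr0; first by case: (side a == s).
  by move=> l /negbTE ->; case: ifP.
split=> [l lC|s].
  rewrite mxE big1 // => i _; rewrite mxE.
  have [le|_] := eqVneq l (e i); first by rewrite le eC in lC.
  have [lt|_] := eqVneq l (t (side (e i))); first by rewrite lt tC in lC.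
  by rewrite subrr mulr0.
under eq_bigr => l _ do rewrite mxE.
rewrite exchange_big big1 //= => i _; rewrite -mulr_sumr.
under eq_bigr => l _ do rewrite mxE.
by rewrite sumrB !sum1 tside subrr mulr0.
Qed.

(** A tangent vector vanishes as soon as its coordinates at the points e i do, as on each
    side one coordinate t s is left and the coordinates of a side add up to 0. *)
Lemma tangent_coords0 w : tangent C w -> coords w = 0 -> w = 0.
Proof.
move=> [w0 ws] /rowP cw.
have we i : w 0 (e i) = 0 by have := cw i; rewrite !mxE.
have wt s : w 0 (t s) = 0.
  have := ws s; rewrite (bigD1 (t s)) ?tside //= big1 ?addr0 // => l /andP[/eqP ls lt].
  have [/w0 //|/negPn lC] := boolP (l \notin C).
  have [lts|[i ->]] := cover lC; last exact: we.
  by rewrite lts ls eqxx in lt.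
apply/rowP => l; rewrite [RHS]mxE.
have [/w0 //|/negPn lC] := boolP (l \notin C).
by have [->|[i ->]] := cover lC.
Qed.

Lemma chartK w : tangent C w -> coords w *m chart_mx = w.
Proof.
move=> tw; apply/subr0_eq/tangent_coords0.
  by apply: tangentB => //; exact: chart_tangent.
by rewrite coordsB coordsK subrr.
Qed.

Definition chart_gauge (z : 'rV[R]_d) := face_gauge C (z *m chart_mx).

Lemma chart_gauge_gauge : gauge chart_gauge.
Proof.
split=> [|z|a z a0|z i].
- apply: continuous_bigmax => l _ z.
  apply: (@continuousM R _ (fun z : 'rV[R]_d => - (z *m chart_mx) 0 l)
    (fun=> (barycenter C 0 l)^-1)); last exact: cst_continuous.
  apply: continuousN.
  apply: (@continuous_comp _ _ _ (fun z : 'rV[R]_d => z *m chart_mx)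
    (fun w : 'rV[R]_N => w 0 l)); first exact: continuous_mulmxr.
  exact: coord_continuous.
- exact: face_gauge_ge0.
- rewrite /chart_gauge /face_gauge.
  rewrite (big_morph (fun y => a * y) (id1 := 0) (op1 := Num.max)) ?mulr0 //.
    by apply: eq_bigr => l _; rewrite -scalemxAl mxE -mulrN mulrA.
  by move=> x y; rewrite maxr_pMr.
- rewrite -{1}[z]coordsK mxE; apply: face_gauge_tangent => //; exact: chart_tangent.
Qed.

Definition disk_to_face (z : 'rV[R]_d) : 'rV[R]_N :=
  barycenter C + radial (@euclid R d) chart_gauge z *m chart_mx.

Definition face_to_disk x : 'rV[R]_d :=
  radial chart_gauge (@euclid R d) (coords (x - barycenter C)).

Lemma disk_to_face_continuous : continuous disk_to_face.
Proof.
move=> z; apply: (@continuousD _ _ _ (fun=> barycenter C)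
  (fun z => radial (@euclid R d) chart_gauge z *m chart_mx)).
  exact: cst_continuous.
apply: (@continuous_comp _ _ _ (radial (@euclid R d) chart_gauge) (mulmx^~ chart_mx)).
  by apply: radial_continuous; [exact: euclid_gauge|exact: chart_gauge_gauge].
exact: continuous_mulmxr.
Qed.

Lemma face_to_disk_continuous : continuous face_to_disk.
Proof.
move=> x; apply: (@continuous_comp _ _ _ (fun x => coords (x - barycenter C)));
  last by apply: radial_continuous; [exact: chart_gauge_gauge|exact: euclid_gauge].
move: x; apply: continuous_coord => i j.
under eq_fun => x do rewrite !mxE.
move=> x; apply: (@continuousB _ _ _ (fun x : 'rV[R]_N => x 0 (e j))
  (fun=> _)); last exact: cst_continuous.
exact: coord_continuous.
Qed.

Lemma disk_to_faceK : cancel disk_to_face face_to_disk.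
Proof.
move=> z; rewrite /face_to_disk /disk_to_face addrAC subrr add0r coordsK radialK //.
  exact: euclid_gauge.
exact: chart_gauge_gauge.
Qed.

Lemma face_to_diskK x : simplex_product x -> supp x \subset C ->
  disk_to_face (face_to_disk x) = x.
Proof.
move=> px sx; rewrite /face_to_disk /disk_to_face radialK; last 2 first.
- exact: chart_gauge_gauge.
- exact: euclid_gauge.
rewrite chartK; first by rewrite addrC subrK.
exact: tangent_barycenter.
Qed.

Lemma disk_to_face_closed z : euclid z <= 1 <->
  simplex_product (disk_to_face z) /\ supp (disk_to_face z) \subset C.
Proof.
rewrite -face_gauge_le1 //; last exact: chart_tangent.
rewrite -[face_gauge _ _]/(chart_gauge _) gauge_radial //.
  exact: euclid_gauge.
exact: chart_gauge_gauge.
Qed.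

Lemma disk_to_face_open z : euclid z < 1 <->
  simplex_product (disk_to_face z) /\ supp (disk_to_face z) = C.
Proof.
rewrite -face_gauge_lt1 //; last exact: chart_tangent.
rewrite -[face_gauge _ _]/(chart_gauge _) gauge_radial //.
  exact: euclid_gauge.
exact: chart_gauge_gauge.
Qed.

End Chart.

(** The closed face spanned by C is homeomorphic to a disk, with the open face
    corresponding to the open disk.  Coordinates are taken at the points of C other than
    one chosen base point on each side, which accounts for the dimension. *)
Lemma transversal_chart C d : transversal C -> d = (#|C| - #|J|)%N ->
  exists (f : 'rV[R]_d -> 'rV[R]_N) (g : 'rV[R]_N -> 'rV[R]_d),
  [/\ continuous f, continuous g, cancel f g,
      forall x, simplex_product x -> supp x \subset C -> f (g x) = x
    & forall z, (euclid z <= 1 <-> simplex_product (f z) /\ supp (f z) \subset C) /\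
                (euclid z < 1 <-> simplex_product (f z) /\ supp (f z) = C)].
Proof.
move=> tC dE; have [t tP] := transversal_section tC.
have t_inj : injective t.
  by apply: (can_inj (g := side)) => s; have [] := tP s.
pose D := finset.setD C (finset.finset (fun l => l \in codom t)).
have cD : #|D| = d.
  rewrite dE cardsD; congr (_ - _)%N; rewrite -(card_codom t_inj).
  apply: eq_card => l; rewrite !inE; apply: andb_idl => /codomP[s ->].
  by have [] := tP s.
pose e (i : 'I_d) := enum_val (cast_ord (esym cD) i).
have eD i : e i \in D by exact: enum_valP.
have h1 s : t s \in C by have [] := tP s.
have h2 s : side (t s) = s by have [] := tP s.
have h3 i : e i \in C by have := eD i; rewrite !inE => /andP[].
have h4 : injective e by move=> i i' /enum_val_inj /cast_ord_inj.
have h5 i s : e i != t s.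
  have := eD i; rewrite !inE => /andP[h _]; apply: contra h => /eqP ->.
  exact: codom_f.
have h6 l : l \in C -> l = t (side l) \/ exists i, l = e i.
  move=> lC; have [/codomP[s ls]|lt] := boolP (l \in codom t).
    by left; rewrite ls h2.
  have lD : l \in D by rewrite !inE lt.
  right; exists (cast_ord cD (enum_rank_in lD l)).
  by rewrite /e cast_ordK enum_rankK_in.
exists (disk_to_face C t e), (face_to_disk C t e); split.
- exact: disk_to_face_continuous.
- exact: face_to_disk_continuous.
- exact: disk_to_faceK.
- by move=> x; exact: face_to_diskK.
- by move=> z; split; [exact: disk_to_face_closed|exact: disk_to_face_open].
Qed.

Local Notation X := (set_type simplex_product).
Local Notation pt := (set_val : X -> 'rV[R]_N).

Lemma pt_simplex (x : X) : simplex_product (pt x).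
Proof. exact: set_valP. Qed.

Lemma pt_continuous : continuous pt.
Proof. exact: initial_continuous. Qed.

Lemma pt_surj w : simplex_product w -> exists x : X, pt x = w.
Proof. by move=> sw; exists (SigSub (mem_set sw)). Qed.

Lemma pt_hausdorff : hausdorff_space X.
Proof.
move=> p q h; apply/val_inj/(@norm_hausdorff R 'rV[R]_N) => A B pA qB.
have [z [Az Bz]] := h _ _ (pt_continuous pA) (pt_continuous qB).
by exists (pt z).
Qed.

Definition face C : set X := [set x | supp (pt x) = C].

(** A point of a closed face is the limit of the points of the segment that joins it to
    the barycenter, and all of these but the point itself have full support. *)
Lemma face_closure C : transversal C ->
  closure (face C) = [set x : X | supp (pt x) \subset C].
Proof.
move=> tC; apply/seteqP; split=> [x xC|x /= sx].
  apply/fintype.subsetP => l; rewrite inE; apply: contraLR => lC; rewrite -leNgt.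
  rewrite leNgt; apply/negP => xl.
  have [y [yC]] : face C `&` [set y : X | 0 < pt y 0 l] !=set0.
    apply: xC; apply: (@pt_continuous x [set w | 0 < w 0 l]).
    apply: (@coord_continuous R 1 N 0 l (pt x) [set r | 0 < r]).
    exact: lt_nbhsr.
  move=> /= yl; case/negP: lC; rewrite -yC inE //.
move=> U [_ [[V oV <-] /= xV VU]].
have [x0 x1] := pt_simplex x.
(* The segment from x to the barycenter; a small t > 0 gives a point of the open face in U. *)
pose p (t : R) := (1 - t) *: pt x + t *: barycenter C.
have pE t l : p t 0 l = (1 - t) * pt x 0 l + t * barycenter C 0 l.
  by rewrite mxE; congr (_ + _); rewrite mxE.
have pc : p t @[t --> (0:R)] --> pt x.
  have p0 : p 0 = pt x by rewrite /p subr0 scale1r scale0r addr0.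
  rewrite -p0; apply: (@continuousD R 'rV[R]_N R (fun t => (1 - t) *: pt x)
    (fun t => t *: barycenter C) 0).
    apply: (@continuous_comp _ _ _ (fun t : R => 1 - t) (fun r => r *: pt x)).
      by apply: (@continuousB R R R (fun=> 1) id); [exact: cst_continuous|exact: cvg_id].
    exact: scalel_continuous.
  exact: scalel_continuous.
have nt : \forall t \near (0:R)^'+, ([set w | V w] (p t) /\ t < 1) /\ 0 < t.
  near=> t; split; [split|].
  - near: t; exact: (cvg_at_right_filter pc (open_nbhs_nbhs (conj oV xV))).
  - by near: t; apply: nbhs_right_lt.
  - by near: t; apply: nbhs_right_gt.
have [t] := @filter_ex _ _ (at_right_proper_filter _) _ nt.
move=> /= [[pV t1] t0].
have t1' : 0 < 1 - t by rewrite subr_gt0.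
have sp : simplex_product (p t).
  split=> [l|s].
    by rewrite pE addr_ge0 // mulr_ge0 ?(ltW t0) ?(ltW t1') // barycenter_ge0.
  under eq_bigr => l _ do rewrite pE.
  by rewrite big_split /= -!mulr_sumr x1 barycenter_sum // !mulr1 subrK.
have [y yp] := pt_surj sp.
exists y; split; last by apply: VU => /=; rewrite /preimage /= yp.
apply/setP => l; rewrite yp inE pE.
have [lC|lC] := boolP (l \in C).
  by apply: ltr_wpDl; [rewrite mulr_ge0 // ltW|rewrite mulr_gt0 // barycenter_gt0].
rewrite barycenter_out // mulr0 addr0 pmulr_rgt0 //.
by apply: contraNF lC => xl; apply: (fintype.subsetP sx); rewrite inE.
Unshelve. all: by end_near. Qed.

(** The open faces of a product of simplices are indexed by the sets of vertices that meet
    every side, so any cell data with this face poset and these dimensions is realized by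
    the product of simplices. *)
Theorem simplex_product_regular (K : cell_data) (S : cells K -> {set 'I_N}) :
    injective S -> (forall C, transversal C <-> exists c, S c = C) ->
    (forall c, cell_dim c = (#|S c| - #|J|)%N) ->
    (forall c' c, cell_face c' c = (S c' \subset S c)) ->
  regular_cell_complex R K.
Proof.
move=> S_inj S_trans Sdim Sface.
have trS c : transversal (S c) by apply/S_trans; exists c.
exists X, (fun c => face (S c)); split.
- exact: pt_hausdorff.
- split.
    apply/seteqP; split=> // x _; have /supp_transversal/S_trans [c cx] := pt_simplex x.
    by exists c.
  by move=> c c' _ _ [x [xc xc']]; apply: S_inj; rewrite -xc -xc'.
- move=> c; have [f [g [fc gc fK gK fP]]] := transversal_chart (trS c) (Sdim c).
  have [b bE] := pt_surj (barycenter_simplex (trS c)).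
  pose f' z := insubd b (f z).
  have ptf z : euclid z <= 1 -> pt (f' z) = f z.
    by move=> /(fP z).1 [sf _]; rewrite /= set_valE insubdK //; exact: mem_set.
  exists f', (g \o pt); rewrite face_closure //; split.
  + apply/subspace_sigL_continuousP; apply: continuous_comp_initial.
    rewrite (_ : _ \o _ = sigL (closed_disk R (cell_dim c)) f).
      by apply/subspace_sigL_continuousP/continuous_subspaceT.
    apply/funext => z; rewrite /= /sigL /=; apply: ptf.
    by apply/closed_diskE; exact: set_valP.
  + apply: continuous_subspaceT => x; apply: continuous_comp; last exact: gc.
    exact: pt_continuous.
  + by move=> z; rewrite inE => /closed_diskE z1; rewrite /= ptf // fK.
  + apply/seteqP; split=> [_ [z /closed_diskE z1 <-] /=|x /= sx].
      by rewrite ptf //; have [_ ] := (fP z).1.1 z1.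
    have fgx := gK _ (pt_simplex x) sx.
    have gx1 : euclid (g (pt x)) <= 1.
      by apply/(fP _).1; rewrite fgx; split=> //; exact: pt_simplex.
    exists (g (pt x)); first exact/closed_diskE.
    by apply: val_inj; have := ptf _ gx1; rewrite set_valE fgx.
  + apply/seteqP; split=> [_ [z /open_diskE z1 <-] /=|x /= sx].
      by rewrite /face /= ptf ?ltW //; have [_ ] := (fP z).2.1 z1.
    have fgx : f (g (pt x)) = pt x by apply: gK; [exact: pt_simplex|rewrite sx].
    have gx1 : euclid (g (pt x)) < 1.
      by apply/(fP _).2; rewrite fgx; split=> //; exact: pt_simplex.
    exists (g (pt x)); first exact/open_diskE.
    by apply: val_inj; have := ptf _ (ltW gx1); rewrite set_valE fgx.
- move=> c x; rewrite face_closure // => -[/= sx nx].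
  have tx := supp_transversal (pt_simplex x).
  have [c' cx] := (S_trans _).1 tx.
  exists c' => //=; rewrite !Sdim; apply: ltn_sub2r.
    apply: leq_ltn_trans (transversal_card tx) _.
    by apply: proper_card; rewrite finset.properEneq sx andbT; apply/eqP.
  by rewrite cx; apply: proper_card; rewrite finset.properEneq sx andbT; apply/eqP.
- move=> c' c; rewrite Sface face_closure //; split=> [sc x /= -> //|].
  have [b bE] := pt_surj (barycenter_simplex (trS c')).
  by move=> /(_ b); rewrite /face /= bE supp_barycenter; exact.
Qed.
End SimplexProduct.

End ProductOfSimplices.

Import boolp mpoly.
Import Order.TTheory GRing.Theory Num.Theory.
Local Open Scope ring_scope.

(** * Koszul signs and the cone homotopy *)

Section SignedChains.
Variables (N : nat) (R : comNzRingType).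
Implicit Types (C : {set 'I_N}) (c : {set 'I_N} -> R) (a b l : 'I_N).

Lemma rank_belowU1 C a l : a \notin C -> rank_below (a |: C) l = ((a < l) + rank_below C l)%N.
Proof.
move=> aC; rewrite /rank_below -!sum1_card big_mkcond [in RHS]big_mkcond /=.
rewrite (bigD1 a) //= [in RHS](bigD1 a) //= !inE eqxx (negbTE aC) /=.
rewrite add0n -[X in (X + _)%N = _]/(nat_of_bool (a < l)%N); congr addn.
by apply: eq_bigr => i /negbTE ia; rewrite !inE ia.
Qed.

(** Adding a and b to C in the two possible orders gives opposite signs: exactly one of a, b
    lies below the other and is counted in its rank.  Hence
    [koszul_bdK] and the incidence relations of the cell complex. *)
Lemma sign_swap C a b : a \notin C -> b \notin C -> a != b ->
  (-1) ^+ rank_below C a * (-1) ^+ rank_below (a |: C) b =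
  - ((-1) ^+ rank_below C b * (-1) ^+ rank_below (b |: C) a) :> R.
Proof.
move=> aC bC ab; rewrite !rank_belowU1 // !exprD.
have /orP[h|h] : (a < b)%N || (b < a)%N by rewrite -neq_ltn.
  by rewrite h (ltnNge b) (ltnW h) /= expr0 expr1; ring.
by rewrite h (ltnNge a) (ltnW h) /= expr0 expr1; ring.
Qed.

(** A chain is given by its coefficients, so that the coefficient at C of the boundary
    collects contributions from the sets that have one more element. *)
Definition koszul_bd c C : R :=
  \sum_(l | l \notin C) (-1) ^+ rank_below C l * c (l |: C).

(** The operator that adds the vertex a to every simplex, read on coefficients. *)
Definition cone a c C : R :=
  if a \in C then (-1) ^+ rank_below C a * c (C :\ a) else 0.

Lemma koszul_bdK c C : koszul_bd (koszul_bd c) C = 0.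
Proof.
pose V (p : 'I_N * 'I_N) := [&& p.1 \notin C, p.2 \notin C & p.1 != p.2].
pose T (p : 'I_N * 'I_N) : R := (-1) ^+ rank_below C p.1 *
  (-1) ^+ rank_below (p.1 |: C) p.2 * c (p.2 |: (p.1 |: C)).
have -> : koszul_bd (koszul_bd c) C = \sum_(p | V p) T p.
  rewrite /koszul_bd.
  under eq_bigr => l _ do rewrite mulr_sumr.
  rewrite pair_big_dep /=; apply: eq_big => [[l l']|[l l'] _] /=.
    by rewrite /V /= !inE negb_or andbA eq_sym; case: (l \in C); case: (l' \in C); case: eqP.
  by rewrite mulrA.
(* The two halves of the sum cancel, in any characteristic. *)
have sw : injective (fun p : 'I_N * 'I_N => (p.2, p.1)) by move=> [? ?] [? ?] [-> ->].
rewrite (bigID (fun p : 'I_N * 'I_N => (p.1 < p.2)%N)) /=.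
rewrite [X in _ + X](reindex_inj sw) /= -[X in X + _]opprK -sumrN addrC.
apply/eqP; rewrite subr_eq0; apply/eqP; apply: eq_big => [[l l']|[l l']].
  rewrite /V /=; case: (l \in C); case: (l' \in C) => //=.
  rewrite (eq_sym l'); have [//|nll'] /= := eqVneq l l'.
  by rewrite -leqNgt [RHS]ltn_neqAle (inj_eq val_inj) nll'.
rewrite /V /T /= => /andP[/and3P[lC l'C ll'] _].
by rewrite [in LHS]sign_swap // finset.setUCA mulNr.
Qed.

(** The cone at any vertex contracts the full simplex, the empty set included. *)
Lemma koszul_cone a c C : koszul_bd (cone a c) C = c C - cone a (koszul_bd c) C.
Proof.
have ss C' l : ((-1) ^+ rank_below C' l * (-1) ^+ rank_below C' l = 1 :> R).
  by rewrite -expr2 sqrr_sign.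
have [aC|aC] := boolP (a \in C); last first.
  rewrite {2}/cone (negbTE aC) subr0 /koszul_bd (bigD1 a) //= big1 ?addr0.
    rewrite /cone setU11 setU1K // mulrA rank_belowU1 // ltnn add0n ss.
    by rewrite mul1r.
  move=> l /andP[lC la]; rewrite /cone !inE (negbTE aC) eq_sym (negbTE la).
  by rewrite mulr0.
rewrite {2}/cone aC; set C0 := C :\ a.
have CE : C = a |: C0 by rewrite setD1K.
have aC0 : a \notin C0 by rewrite !inE eqxx.
rewrite [koszul_bd c C0](bigD1 a) //= mulrDr mulrA -CE.
have rCa : rank_below C a = rank_below C0 a by rewrite {1}CE rank_belowU1 // ltnn.
rewrite rCa ss mul1r opprD addNKr -mulrN -sumrN mulr_sumr /koszul_bd.
apply: eq_big => [l|l lC].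
  by rewrite !inE negb_and negbK; case: (eqVneq l a) => [->|]; rewrite ?aC ?andbF ?andbT.
have la : l != a by apply: contraNneq lC => ->.
have lC0 : l \notin C0 by rewrite !inE negb_and lC orbT.
rewrite /cone !inE aC orbT !mulrA mulrN mulrA -mulNr (_ : (l |: C) :\ a = l |: C0); last first.
  apply/setP => i; rewrite !inE; case: (eqVneq i a) => [->|] //=.
  by rewrite eq_sym (negbTE la).
congr (_ * _); rewrite (rank_belowU1 a lC) {1}CE rank_belowU1 // rCa !exprD.
have /orP[h|h] : (a < l)%N || (l < a)%N by rewrite -neq_ltn eq_sym.
  by rewrite h (ltnNge l) (ltnW h) /= expr0 expr1; ring.
by rewrite h (ltnNge a) (ltnW h) /= expr0 expr1; ring.
Qed.

End SignedChains.

(** * The quotient complex of sets meeting both sides *)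

Section TruncatedComplex.
Variables (N : nat) (R : comNzRingType) (left : pred 'I_N).
Implicit Types (C : {set 'I_N}) (c e y : {set 'I_N} -> R) (a b l : 'I_N).

Definition full C := [exists l in C, left l] && [exists l in C, ~~ left l].

Definition right_only C := [forall l in C, ~~ left l].

Definition supported_full c := forall C, ~~ full C -> c C = 0.

(** With the left vertices numbered first, this is on chains of edges of the bipartite graph
    the sum of all coefficients, taken over the right end b and then over the left end.  It
    is the differential from degree 1 to degree 0, and it vanishes on chains of larger sets. *)
Definition augmentation c : R := \sum_(b | ~~ left b) koszul_bd c [set b].

Definition truncated_bd c C : R := if full C then koszul_bd c C else 0.

(** For a chain c supported on full sets, this pushes the part of c with exactly one left
    vertex to the right-hand simplex, forgetting the left vertex. *)
Definition right_edge c C : R := if right_only C then koszul_bd c C else 0.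

(** The contraction of a product of two simplices: first slide everything to the vertex a
    of the left simplex, and then, within the copy of the right simplex over a, to b. *)
Definition truncated_cone a b c C : R :=
  cone a c C - cone a (cone b (right_edge c)) C.

Lemma fullU1 C l : full C -> full (l |: C).
Proof.
case/andP=> /exists_inP[a aC la] /exists_inP[b bC lb]; apply/andP; split.
  by apply/exists_inP; exists a; rewrite // setU1r.
by apply/exists_inP; exists b; rewrite // setU1r.
Qed.

Lemma full_supset C C' : C \subset C' -> full C -> full C'.
Proof.
move=> /fintype.subsetP CC' /andP[/exists_inP[a aC la] /exists_inP[b bC lb]].
apply/andP; split; first by apply/exists_inP; exists a; rewrite ?CC'.
by apply/exists_inP; exists b; rewrite ?CC'.
Qed.

Lemma full_right_only C : full C -> right_only C = false.
Proof.
case/andP=> /exists_inP[a aC la] _; apply/negbTE/negP => /forall_inP /(_ a aC).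
by rewrite la.
Qed.

Lemma rank_below_left C a : (forall a b, left a -> ~~ left b -> (a < b)%N) ->
  left a -> right_only C -> rank_below C a = 0%N.
Proof.
move=> left_lt la /forall_inP rC; apply/eq_card0 => l; rewrite !inE; apply/negbTE.
rewrite negb_and; case: (boolP (l \in C)) => //= lC.
by rewrite -leqNgt ltnW // left_lt // rC.
Qed.

(** Pushing forward to the right-hand simplex commutes with the differential; at the empty
    set, where there is no differential of c to refer to, the claim is the hypothesis on
    the augmentation. *)
Lemma right_edge_bd c : (forall C, full C -> koszul_bd c C = 0) ->
  augmentation c = 0 -> forall C, koszul_bd (right_edge c) C = 0.
Proof.
move=> c_cycle c_aug C; rewrite /koszul_bd.
have [Cr|Cr] := boolP (right_only C); last first.
  apply: big1 => l lC; rewrite /right_edge ifF ?mulr0 //.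
  apply/negbTE; apply: contra Cr => /forall_inP h; apply/forall_inP => i iC.
  by rewrite h // setU1r.
rewrite (bigID left) /= big1 ?add0r => [|l /andP[lC ll]]; last first.
  rewrite /right_edge ifF ?mulr0 //; apply/negbTE/negP => /forall_inP /(_ l).
  by rewrite setU11 ll => /(_ isT).
rewrite (eq_bigr (fun l => (-1) ^+ rank_below C l * koszul_bd c (l |: C))); last first.
  move=> l /andP[lC ll]; rewrite /right_edge ifT //; apply/forall_inP => i.
  by rewrite in_setU1 => /predU1P[->//|/(forall_inP Cr)].
have [C0|/set0Pn[b bC]] := eqVneq C finset.set0.
  rewrite C0 -[RHS]c_aug; apply: eq_big => [l|l _]; first by rewrite inE.
  by rewrite finset.setU0 [rank_below _ _]eq_card0 ?mul1r // => i; rewrite !inE.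
rewrite -[RHS](koszul_bdK c C) [RHS](bigID left) /= [X in _ = X + _]big1 ?add0r //.
move=> l /andP[lC ll]; rewrite c_cycle ?mulr0 //; apply/andP; split.
  by apply/exists_inP; exists l; rewrite ?setU11.
by apply/exists_inP; exists b; [rewrite setU1r|exact: (forall_inP Cr)].
Qed.

Lemma koszul_bdB c e C : koszul_bd (fun C => c C - e C) C = koszul_bd c C - koszul_bd e C.
Proof. by rewrite -sumrB; apply: eq_bigr => l _; rewrite mulrBr. Qed.

(** In the full Koszul complex the boundary of the cone over c misses c by the cone over the
    boundary of c, and the boundary of c is supported on sets that miss a side.  On full
    sets only its part [right_edge c] is seen, and this part is a cycle, hence the boundary
    of its cone towards b; the second term of [truncated_cone] corrects for it. *)
Lemma truncated_cone_bd a b c : left a -> ~~ left b ->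
  (forall C, full C -> koszul_bd c C = 0) -> augmentation c = 0 ->
  forall C, full C -> koszul_bd (truncated_cone a b c) C = c C.
Proof.
move=> la lb c_cycle c_aug C Cfull.
have e0 := right_edge_bd c_cycle c_aug.
have [/exists_inP[a' a'C la'] /exists_inP[b' b'C lb']] := andP Cfull.
rewrite koszul_bdB !koszul_cone.
have -> : cone b (right_edge c) C = 0.
  rewrite /cone; case: ifP => // bC; rewrite /right_edge ifF ?mulr0 //.
  apply/negbTE/negP => /forall_inP /(_ a').
  rewrite in_setD1 a'C andbT la' /=; case: eqP => [a'b|_ /(_ isT) //].
  by rewrite a'b (negbTE lb) in la'.
suff -> : cone a (koszul_bd (cone b (right_edge c))) C = cone a (koszul_bd c) C by ring.
rewrite /cone; case: ifP => // aC; congr (_ * _).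
rewrite koszul_cone {1}/cone e0 mulr0 if_same subr0 /right_edge; case: ifP => // h.
symmetry; apply: c_cycle; apply/andP; split; last first.
  apply/exists_inP; exists b' => //; rewrite in_setD1 b'C andbT.
  by apply: contraNneq lb' => ->.
move/negbT: h; rewrite negb_forall_in => /exists_inP[i iC]; rewrite negbK => li.
by apply/exists_inP; exists i.
Qed.

Lemma truncated_bdK c C : full C -> koszul_bd (truncated_bd c) C = 0.
Proof.
move=> Cfull; rewrite -[RHS](koszul_bdK c C); apply: eq_bigr => l _.
by rewrite /truncated_bd fullU1.
Qed.

(** Splitting the boundary of c into its full, right-only and remaining parts, the remaining
    part is invisible next to a right vertex, so up to sign the augmentation is that of the
    right-only part e.  That is the boundary of the boundary of e, at the empty set. *)
Lemma augmentation_truncated_bd c : augmentation (truncated_bd c) = 0.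
Proof.
pose e := right_edge c.
have be b : ~~ left b -> koszul_bd (truncated_bd c) [set b] = - koszul_bd e [set b].
  move=> lb; apply/eqP; rewrite -addr_eq0 -[X in _ == X](koszul_bdK c [set b]).
  rewrite -big_split; apply/eqP/eq_bigr => l lnb /=; rewrite -mulrDr; congr (_ * _).
  have [ll|ll] := boolP (left l).
    have lf : full (l |: [set b]).
      apply/andP; split; first by apply/exists_inP; exists l; rewrite ?setU11.
      by apply/exists_inP; exists b; rewrite ?setU1r ?set11.
    by rewrite /truncated_bd /e /right_edge lf full_right_only // addr0.
  have lr : right_only (l |: [set b]).
    by apply/forall_inP => i; rewrite !inE => /orP[] /eqP ->.
  rewrite /truncated_bd /e /right_edge lr ifF ?add0r //.
  by apply/negbTE/negP => /full_right_only; rewrite lr.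
rewrite /augmentation (eq_bigr (fun b => - koszul_bd e [set b])) //.
rewrite sumrN; apply/eqP; rewrite oppr_eq0 -[X in _ == X](koszul_bdK e finset.set0).
rewrite {2}/koszul_bd [X in _ == X](bigID left) /= [X in _ == X + _]big1 ?add0r; last first.
  move=> l /andP[_ ll]; rewrite /koszul_bd big1 ?mulr0 // => i _.
  rewrite /e /right_edge ifF ?mulr0 //; apply/negbTE/negP => /forall_inP /(_ l).
  by rewrite finset.setU0 !inE eqxx orbT ll => /(_ isT).
apply/eqP/eq_big => [l|l ll]; first by rewrite inE.
by rewrite finset.setU0 [rank_below _ _]eq_card0 ?mul1r // => i; rewrite !inE.
Qed.

Lemma truncated_cone_supported a b c : left a -> ~~ left b ->
  supported_full c -> supported_full (truncated_cone a b c).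
Proof.
move=> la lb c0 C Cf; rewrite /truncated_cone.
have -> : cone a c C = 0.
  rewrite /cone; case: ifP => // aC; rewrite c0 ?mulr0 //.
  by apply: contra Cf; apply: full_supset; exact: finset.subsetDl.
suff -> : cone a (cone b (right_edge c)) C = 0 by rewrite subr0.
rewrite /cone; case: ifP => // aC; case: ifP => [bC|]; last by rewrite mulr0.
case/negP: Cf; apply/andP; split; first by apply/exists_inP; exists a.
by apply/exists_inP; exists b => //; move: bC; rewrite in_setD1 => /andP[].
Qed.

Lemma truncated_cone_card a b c r : (forall C, #|C| != r -> c C = 0) ->
  forall C, #|C| != r.+1 -> truncated_cone a b c C = 0.
Proof.
move=> c0 C Cr; rewrite /truncated_cone.
have cD l C' k : l \in C' -> #|C'| != k.+1 -> #|C' :\ l| != k.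
  by move=> lC'; rewrite (cardsD1 l C') lC' add1n eqSS.
have -> : cone a c C = 0.
  by rewrite /cone; case: ifP => // aC; rewrite c0 ?mulr0 // cD.
suff -> : cone a (cone b (right_edge c)) C = 0 by rewrite subr0.
rewrite /cone; case: ifP => // aC; case: ifP => [bC|]; last by rewrite mulr0.
rewrite /right_edge; case: ifP => _; last by rewrite !mulr0.
rewrite /koszul_bd big1 ?mulr0 // => l lC; rewrite c0 ?mulr0 //.
rewrite cardsU1 lC add1n; apply: contra Cr => /eqP <-.
by rewrite (cardsD1 a) aC (cardsD1 b) bC.
Qed.

End TruncatedComplex.

(** * Exactness for families of polynomials divisible by labels *)

Section MonomialParts.
Variables (N : nat) (k : fieldType) (lam : 'I_N -> nat).
Local Notation S := {mpoly k[N]}.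
Implicit Types (C : {set 'I_N}) (p q : S) (f mu : 'X_{1..N}).

Definition weight_mnm C : 'X_{1..N} := [multinom (if l \in C then lam l else 0%N) | l < N].

Lemma weight_mnm_leP C mu :
  reflect (forall l, l \in C -> (lam l <= mu l)%N) (weight_mnm C <= mu)%MM.
Proof.
apply: (iffP mnm_lepP) => h l; first by move=> lC; have := h l; rewrite mnmE lC.
by rewrite mnmE; case: ifP => // /h.
Qed.

Definition monomial_part (P : pred 'X_{1..N}) p : S :=
  \sum_(mu <- msupp p | P mu) p@_mu *: 'X_[mu].

Lemma mcoeff_monomial_part P p mu :
  (monomial_part P p)@_mu = if P mu then p@_mu else 0.
Proof.
rewrite /monomial_part raddf_sum /= big_mkcond /=.
have [pmu|pmu] := boolP (mu \in msupp p).
  rewrite (bigD1_seq mu) //= big1 ?addr0 => [|nu /negbTE nmu].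
    by rewrite mcoeffZ mcoeffX eqxx mulr1.
  by rewrite mcoeffZ mcoeffX nmu mulr0 if_same.
rewrite (memN_msupp_eq0 pmu) if_same big_seq big1 // => nu pnu.
rewrite mcoeffZ mcoeffX; case: eqP => [nm|]; last by rewrite mulr0 if_same.
by rewrite -nm pnu in pmu.
Qed.

Lemma monomial_part_additive P : zmod_morphism (monomial_part P).
Proof.
move=> p q; apply/mpolyP => mu; rewrite mcoeffB !mcoeff_monomial_part mcoeffB.
by case: ifP => // _; rewrite subr0.
Qed.

HB.instance Definition _ P := GRing.isZmodMorphism.Build S S (monomial_part P)
  (monomial_part_additive P).

(** Divisibility of a polynomial by a monomial, tested on its support. *)
Definition mnm_divides f p := forall mu, p@_mu != 0 -> (f <= mu)%MM.

Lemma mnm_divides0 f : mnm_divides f 0.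
Proof. by move=> mu; rewrite mcoeff0 eqxx. Qed.

Lemma mnm_dividesD f p q : mnm_divides f p -> mnm_divides f q -> mnm_divides f (p + q).
Proof.
move=> fp fq mu; rewrite mcoeffD.
have [->|/fp //] := eqVneq p@_mu 0; rewrite add0r; exact: fq.
Qed.

Lemma mnm_dividesN f p : mnm_divides f p -> mnm_divides f (- p).
Proof. by move=> fp mu; rewrite mcoeffN oppr_eq0; exact: fp. Qed.

Lemma mnm_divides_sign f i p : mnm_divides f p -> mnm_divides f ((-1) ^+ i * p).
Proof.
by move=> fp; rewrite -signr_odd mulr_sign; case: ifP => // _; exact: mnm_dividesN.
Qed.

Lemma mnm_divides_sum (I : finType) (P : pred I) f (F : I -> S) :
  (forall i, P i -> mnm_divides f (F i)) -> mnm_divides f (\sum_(i | P i) F i).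
Proof. by move=> h; elim/big_ind: _ => //; [exact: mnm_divides0|exact: mnm_dividesD]. Qed.

Lemma mnm_divides_mul f p : mnm_divides f (p * 'X_[f]).
Proof.
move=> mu; rewrite -mcoeff_msupp (perm_mem (msuppMX _ _)) => /mapP[nu _ ->].
exact: lem_addr.
Qed.

Definition mnm_quotient f p : S := \sum_(mu <- msupp p) p@_mu *: 'X_[mu - f].

Lemma mnm_quotientK f p : mnm_divides f p -> mnm_quotient f p * 'X_[f] = p.
Proof.
move=> fp; rewrite [RHS]mpolyE /mnm_quotient mulr_suml big_seq [RHS]big_seq.
apply: eq_bigr => mu; rewrite mcoeff_msupp => /fp fmu.
by rewrite -scalerAl -mpolyXD submK.
Qed.

Section Exactness.
Variable left : pred 'I_N.
Implicit Types (c : {set 'I_N} -> S).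

(** The cones enlarge sets by a and b only, and z_a and z_b divide every monomial present. *)
Lemma truncated_cone_divides a b c :
  (forall C mu, (c C)@_mu != 0 ->
     [/\ (lam a <= mu a)%N, (lam b <= mu b)%N & (weight_mnm C <= mu)%MM]) ->
  forall C, mnm_divides (weight_mnm C) (truncated_cone left a b c C).
Proof.
move=> cdiv C; apply: mnm_dividesD; last apply: mnm_dividesN.
  rewrite /cone; case: ifP => [aC|_]; last exact: mnm_divides0.
  apply: mnm_divides_sign => mu /cdiv [am _ /weight_mnm_leP Cm].
  apply/weight_mnm_leP => l lC; have [->//|la] := eqVneq l a.
  by apply: Cm; rewrite in_setD1 la.
rewrite /cone; case: ifP => [aC|_]; last exact: mnm_divides0.
apply: mnm_divides_sign; case: ifP => [bC|_]; last exact: mnm_divides0.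
apply: mnm_divides_sign; rewrite /right_edge; case: ifP => _; last exact: mnm_divides0.
apply: mnm_divides_sum => l lC; apply: mnm_divides_sign => mu /cdiv [am bm /weight_mnm_leP Cm].
apply/weight_mnm_leP => i iC; have [->//|ia] := eqVneq i a; have [->//|ib] := eqVneq i b.
by apply: Cm; rewrite setU1r // !in_setD1 ia ib.
Qed.

Definition first_left mu := [pick l | left l && (lam l <= mu l)%N].
Definition first_right mu := [pick l | ~~ left l && (lam l <= mu l)%N].

(** The apexes of the cones depend on the monomial, as z_a and z_b have to divide it; these
    projections sort the monomials according to the apexes chosen for them. *)
Definition apex_part a b : {additive S -> S} :=
  monomial_part (fun mu => (first_left mu == Some a) && (first_right mu == Some b)).

Lemma mcoeff_apex_part a b p mu : (apex_part a b p)@_mu =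
  if (first_left mu == Some a) && (first_right mu == Some b) then p@_mu else 0.
Proof. exact: mcoeff_monomial_part. Qed.

Lemma apex_part_sum C p : full left C -> mnm_divides (weight_mnm C) p ->
  \sum_(a | left a) \sum_(b | ~~ left b) apex_part a b p = p.
Proof.
move=> /andP[/exists_inP[a' a'C la'] /exists_inP[b' b'C lb']] Cp.
apply/mpolyP => mu; rewrite raddf_sum /=.
under eq_bigr => a _ do
  (rewrite raddf_sum /=; under eq_bigr => b _ do rewrite mcoeff_apex_part).
have [->|/Cp /weight_mnm_leP Cmu] := eqVneq p@_mu 0.
  by rewrite big1 // => a _; rewrite big1 // => b _; rewrite if_same.
rewrite /first_left /first_right.
case: pickP => [a0 /andP[la0 _]|/(_ a')]; last by rewrite la' Cmu.
case: pickP => [b0 /andP[lb0 _]|/(_ b')]; last by rewrite lb' Cmu.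
rewrite (bigD1 a0) //= (bigD1 b0) //= !eqxx /= !big1 ?addr0 //.
  move=> a /andP[_ /negbTE aa0]; rewrite big1 // => b _.
  by rewrite (inj_eq Some_inj) eq_sym aa0.
by move=> b /andP[_ /negbTE bb0]; rewrite (inj_eq Some_inj) eq_sym bb0.
Qed.

Lemma koszul_bd_map (g : {additive S -> S}) c C :
  koszul_bd (fun C => g (c C)) C = g (koszul_bd c C).
Proof. by rewrite raddf_sum; apply: eq_bigr => l _; rewrite raddfMsign. Qed.

Lemma koszul_bd_sum (I : finType) (P : pred I) (F : I -> {set 'I_N} -> S) C :
  koszul_bd (fun C => \sum_(i | P i) F i C) C = \sum_(i | P i) koszul_bd (F i) C.
Proof.
rewrite /koszul_bd exchange_big /=; apply: eq_bigr => l _.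
by rewrite mulr_sumr.
Qed.

(** The contractions for the various pairs of apexes are applied to the parts of c on which
    they preserve divisibility, and then added up. *)
Lemma divisible_chain_exact r c :
  supported_full left c -> (forall C, mnm_divides (weight_mnm C) (c C)) ->
  (forall C, #|C| != r -> c C = 0) ->
  (forall C, full left C -> koszul_bd c C = 0) -> augmentation left c = 0 ->
  exists y, [/\ supported_full left y, forall C, mnm_divides (weight_mnm C) (y C),
    forall C, #|C| != r.+1 -> y C = 0
  & forall C, full left C -> koszul_bd y C = c C].
Proof.
move=> c_full c_div c_card c_cycle c_aug.
pose ap a b C := apex_part a b (c C).
exists (fun C => \sum_(a | left a) \sum_(b | ~~ left b) truncated_cone left a b (ap a b) C).
split=> C.
- move=> Cf; apply: big1 => a la; apply: big1 => b lb.
  apply: truncated_cone_supported => // C' C'f.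
  by rewrite /ap c_full // raddf0.
- apply: mnm_divides_sum => a la; apply: mnm_divides_sum => b lb.
  apply: truncated_cone_divides => {}C mu; rewrite mcoeff_apex_part.
  rewrite /first_left /first_right.
  case: pickP => [a0 /andP[_ h]|_]; last by rewrite eqxx.
  case: pickP => [b0 /andP[_ h']|_]; last by rewrite andbF eqxx.
  case: ifP => [/andP[/eqP[<-] /eqP[<-]]|]; last by rewrite eqxx.
  by move=> /c_div.
- move=> Cr; apply: big1 => a la; apply: big1 => b lb.
  by apply: truncated_cone_card Cr => C' C'r; rewrite /ap c_card // raddf0.
- move=> Cf; rewrite koszul_bd_sum -[RHS](apex_part_sum Cf (c_div C)).
  apply: eq_bigr => a la; rewrite koszul_bd_sum; apply: eq_bigr => b lb.
  rewrite truncated_cone_bd // => [C' C'f|].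
    by rewrite koszul_bd_map c_cycle // raddf0.
  rewrite -[RHS](raddf0 (apex_part a b)) -c_aug raddf_sum.
  by apply: eq_bigr => i _; rewrite koszul_bd_map.
Qed.

End Exactness.
End MonomialParts.

(** * Faces as subsets of the vertex set of the graph *)

Section Faces.
Variables (m n : nat).
Local Notation N := (m + n)%N.
Local Notation face_pair := ({set 'I_m} * {set 'I_n})%type.
Implicit Types (c : face_pair) (C E : {set 'I_N}).

Definition is_left : pred 'I_N := fun l => (l < m)%N.

Lemma is_left_lt a b : is_left a -> ~~ is_left b -> (a < b)%N.
Proof. by rewrite /is_left -leqNgt; exact: leq_trans. Qed.

Lemma is_left_lshift a : is_left (lshift n a).
Proof. exact: (ltn_ord a). Qed.

Lemma is_left_rshift b : ~~ is_left (rshift m b).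
Proof. by rewrite /is_left /= -leqNgt leq_addr. Qed.

(** The numbering of the variables puts the left vertices first, so that the sign rule for
    the pair (A, B) is the Koszul sign rule for this set ([rank_below_joint_r]). *)
Definition joint c : {set 'I_N} :=
  [set l | match split l with inl a => a \in c.1 | inr b => b \in c.2 end].

Lemma mem_joint_l c a : (lshift n a \in joint c) = (a \in c.1).
Proof. by rewrite inE (unsplitK (inl a)). Qed.

Lemma mem_joint_r c b : (rshift m b \in joint c) = (b \in c.2).
Proof. by rewrite inE (unsplitK (inr b)). Qed.

Definition mem_joint := (mem_joint_l, mem_joint_r).

Lemma joint_surj C : exists c, joint c = C.
Proof.
exists ([set a | lshift n a \in C], [set b | rshift m b \in C]).
by apply/setP => l; case: (split_ordP l) => [a|b] ->; rewrite mem_joint inE.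
Qed.

Lemma joint_sub c c' : (joint c' \subset joint c) = (c'.1 \subset c.1) && (c'.2 \subset c.2).
Proof.
apply/fintype.subsetP/andP => [h|[/fintype.subsetP h1 /fintype.subsetP h2] l].
  by split; apply/fintype.subsetP => i; rewrite -mem_joint => /h; rewrite mem_joint.
by case: (split_ordP l) => [a|b] ->; rewrite !mem_joint; [exact: h1|exact: h2].
Qed.

Lemma joint_inj : injective joint.
Proof.
move=> [A B] [A' B'] /setP h; congr pair; apply/setP => i.
  by have := h (lshift n i); rewrite !mem_joint.
by have := h (rshift m i); rewrite !mem_joint.
Qed.

Lemma card_joint c : #|joint c| = (#|c.1| + #|c.2|)%N.
Proof.
rewrite -!sum1_card [LHS]big_mkcond big_split_ord /= -!big_mkcond /=.
by congr addn; apply: eq_bigl => i; rewrite mem_joint.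
Qed.

Lemma full_joint c : full is_left (joint c) = (c.1 != finset.set0) && (c.2 != finset.set0).
Proof.
apply/andP/andP => -[h1 h2]; split.
- have /exists_inP[l] := h1; case: (split_ordP l) => [a|b] ->; rewrite mem_joint => aC.
    by move=> _; apply/set0Pn; exists a.
  by rewrite (negbTE (is_left_rshift b)).
- have /exists_inP[l] := h2; case: (split_ordP l) => [a|b] ->; rewrite mem_joint => aC.
    by rewrite is_left_lshift.
  by move=> _; apply/set0Pn; exists b.
- have /set0Pn[a aC] := h1; apply/exists_inP; exists (lshift n a).
    by rewrite mem_joint.
  exact: is_left_lshift.
- have /set0Pn[b bC] := h2; apply/exists_inP; exists (rshift m b).
    by rewrite mem_joint.
  exact: is_left_rshift.
Qed.

Lemma jointD1l c a : joint (c.1 :\ a, c.2)%SET = joint c :\ lshift n a.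
Proof.
apply/setP => l; case: (split_ordP l) => [i|i] ->; rewrite in_setD1 !mem_joint /=.
  by rewrite in_setD1 eq_lshift.
by rewrite eq_rlshift.
Qed.

Lemma jointD1r c b : joint (c.1, c.2 :\ b)%SET = joint c :\ rshift m b.
Proof.
apply/setP => l; case: (split_ordP l) => [i|i] ->; rewrite in_setD1 !mem_joint /=.
  by rewrite eq_lrshift.
by rewrite in_setD1 eq_rshift.
Qed.

Lemma rank_belowE q (P : {set 'I_q}) x : rank_below P x = (\sum_(y in P | y < x) 1)%N.
Proof. by rewrite /rank_below -sum1_card; apply: eq_bigl => y; rewrite inE. Qed.

Lemma rank_below_joint_l c a : rank_below (joint c) (lshift n a) = rank_below c.1 a.
Proof.
rewrite !rank_belowE [LHS]big_mkcond big_split_ord /= -!big_mkcond /=.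
rewrite [X in (_ + X)%N]big1 ?addn0.
  by apply: eq_bigl => i; rewrite mem_joint.
move=> b /andP[_]; rewrite ltnNge => /negP[].
exact: leq_trans (ltnW (ltn_ord a)) (leq_addr _ _).
Qed.

Lemma rank_below_joint_r c b :
  rank_below (joint c) (rshift m b) = (#|c.1| + rank_below c.2 b)%N.
Proof.
rewrite !rank_belowE -sum1_card [LHS]big_mkcond big_split_ord /= -!big_mkcond /=.
congr addn; apply: eq_bigl => i; rewrite mem_joint.
  by rewrite ltn_addr ?andbT.
by rewrite ltn_add2l.
Qed.

(** There is at most one term, as E determines l. *)
Definition incidence C E : int :=
  \sum_(l in C | E == C :\ l) (-1) ^+ rank_below C l.

Lemma incidenceU1 E l : l \notin E -> incidence (l |: E) E = (-1) ^+ rank_below E l.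
Proof.
move=> lE; rewrite /incidence (big_pred1 l) => [|i].
  by rewrite rank_belowU1 // ltnn.
rewrite /= in_setU1; have [->|il] /= := eqVneq i l; first by rewrite setU1K ?eqxx.
apply/negbTE/negP => /andP[iE /eqP E_eq].
by have := iE; rewrite E_eq in_setD1 eqxx.
Qed.

Lemma incidence_neq0 C E : incidence C E != 0 <-> exists2 l, l \notin E & C = l |: E.
Proof.
split=> [|[l lE ->]]; last by rewrite incidenceU1 // signr_eq0.
case: (pickP (fun l => (l \in C) && (E == C :\ l))) => [l /andP[lC /eqP ->] _|h].
  by exists l; rewrite ?setD1K // in_setD1 eqxx.
by rewrite /incidence big1 ?eqxx // => l; rewrite h.
Qed.

Lemma incidence_bd (R : comNzRingType) (x : {set 'I_N} -> R) E :
  koszul_bd x E = \sum_C (incidence C E)%:~R * x C.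
Proof.
rewrite /incidence; under eq_bigr => C _ do rewrite rmorph_sum mulr_suml /=.
rewrite (exchange_big_dep xpredT) //= /koszul_bd big_mkcond; apply: eq_bigr => l _.
have [lE|lE] := boolP (l \notin E).
  rewrite (big_pred1 (l |: E)) => [|C]; first by rewrite rmorph_sign rank_belowU1 // ltnn.
  apply/andP/eqP => [[lC /eqP ->]|->]; first by rewrite setD1K.
  by rewrite setU11 setU1K.
rewrite big_pred0 // => C; apply/negbTE; apply: contra lE => /andP[_ /eqP ->].
by rewrite in_setD1 eqxx.
Qed.

End Faces.
Arguments is_left {m n}.

(** * The cell complex and its incidence numbers *)

Section VisscherCells.
Variables (m n : nat).
Local Notation K := (visscher_cells m n).
Implicit Types (u v : vface m n).

Definition vertices u : {set 'I_(m + n)} := joint (val u).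

Lemma vertices_inj : injective vertices.
Proof. by move=> u v /joint_inj /val_inj. Qed.

Lemma vertices_full u : full is_left (vertices u).
Proof. by rewrite full_joint; exact: (valP u). Qed.

Lemma vertices_surj C : full is_left C -> exists u, vertices u = C.
Proof.
have [c <-] := joint_surj C; rewrite full_joint => cC.
by exists (exist _ c cC : vface m n).
Qed.

Lemma vertices_card_ge2 u : (2 <= #|vertices u|)%N.
Proof.
rewrite card_joint; have /andP[] := valP u; rewrite -!card_gt0.
by case: #|_| => // a; case: #|_| => // b _ _; rewrite addSn addnS.
Qed.

Lemma cell_dimE (u : cells K) : cell_dim u = (#|vertices u| - 2)%N.
Proof. by rewrite card_joint. Qed.

Lemma cell_dim_card (u : cells K) d : (cell_dim u == d) = (#|vertices u| == d.+2).
Proof. by have := vertices_card_ge2 u; rewrite cell_dimE; lia. Qed.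

Lemma cell_faceE (u v : cells K) : cell_face u v = (vertices u \subset vertices v).
Proof. by rewrite joint_sub. Qed.

Lemma visscher_regular (R : realType) : regular_cell_complex R K.
Proof.
apply: (@ProductOfSimplices.simplex_product_regular R (m + n) bool is_left K vertices).
- exact: vertices_inj.
- move=> C; split=> [/forallP h|[u <-]].
    apply: vertices_surj; apply/andP; split.
      by have /exists_inP[l lC /eqP ll] := h true; apply/exists_inP; exists l.
    by have /exists_inP[l lC /eqP ll] := h false; apply/exists_inP; exists l; rewrite ?ll.
  have /andP[/exists_inP[a aC la] /exists_inP[b bC lb]] := vertices_full u.
  apply/forallP => -[]; apply/exists_inP; [exists a|exists b] => //; first by rewrite la.
  by rewrite (negbTE lb).
- by move=> c; rewrite card_bool cell_dimE.
- exact: cell_faceE.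
Qed.

Definition visscher_inc (u v : cells K) : int := incidence (vertices u) (vertices v).

(** Full sets have at least two elements, so the truncated subtraction in the dimension is
    exact and dimensions compare like cardinals. *)
Lemma codim1_facet (u v : cells K) : cell_face v u -> cell_dim u = (cell_dim v).+1 ->
  exists2 l, l \notin vertices v & vertices u = l |: vertices v.
Proof.
rewrite cell_faceE !cell_dimE => vu dim_uv.
have cu : #|vertices u| = #|vertices v|.+1.
  by have := vertices_card_ge2 u; have := vertices_card_ge2 v; lia.
have /set0Pn[l] : vertices u :\: vertices v != finset.set0.
  by rewrite -card_gt0 cardsD (finset.setIidPr vu) cu subSnn.
rewrite inE => /andP[lv lu]; exists l => //; apply/esym/eqP.
by rewrite finset.eqEcard finset.subUset sub1set lu vu cardsU1 lv cu add1n leqnn.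
Qed.

(** The relation in codimension 2 is [sign_swap].  For the two ends v, w of an edge it gives
    the relation too: v and w share one vertex p, and the two other vertices lie on the
    same side of the graph, hence have the same sign relative to p. *)
Lemma visscher_incidence_function : incidence_function visscher_inc.
Proof.
split.
- move=> u v; have [->//|/incidence_neq0[l lv uv]] := eqVneq (visscher_inc u v) 0.
  by rewrite /visscher_inc uv incidenceU1 // -signr_odd; case: (odd _).
- move=> u v; split=> [/incidence_neq0[l lv uv]|[vu dim_uv]].
    rewrite cell_faceE !cell_dimE uv; split; first exact: subsetUr.
    by rewrite cardsU1 lv; have := vertices_card_ge2 v; lia.
  by apply/incidence_neq0; exact: codim1_facet.
- move=> u v w u1 v0 w0 vu wu vw.
  have [l lv uv] : exists2 l, l \notin vertices v & vertices u = l |: vertices v.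
    by apply: codim1_facet => //; rewrite v0.
  have [l' lw uw] : exists2 l, l \notin vertices w & vertices u = l |: vertices w.
    by apply: codim1_facet => //; rewrite w0.
  have ll' : l != l'.
    apply: contraNneq vw => ll'; apply/eqP/vertices_inj.
    by rewrite -(setU1K lv) -uv uw -ll' setU1K // ll'.
  have l'v : l' \in vertices v.
    by have : l' \in vertices u; [rewrite uw setU11|rewrite uv in_setU1 eq_sym (negbTE ll')].
  pose E := vertices v :\ l'.
  have vE : vertices v = l' |: E by rewrite setD1K.
  have lE : l \notin E by rewrite in_setD1 negb_and lv orbT.
  have l'E : l' \notin E by rewrite in_setD1 eqxx.
  have wE : vertices w = l |: E.
    rewrite -(setU1K lw) -uw uv vE finset.setUCA setU1K // in_setU1 negb_or eq_sym ll'.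
    exact: l'E.
  have /cards1P[p Ep] : #|E| == 1%N.
    move/eqP: v0; rewrite cell_dim_card vE cardsU1 l'E add1n eqSS; exact.
  have rank_eq : rank_below E l = rank_below E l'.
    have vf := vertices_full v; have wf := vertices_full w.
    have [pl|pr] := boolP (is_left p); last first.
      have Er : right_only is_left E by apply/forall_inP => i; rewrite Ep inE => /eqP ->.
      have left_of i : full is_left (i |: E) -> is_left i.
        case/andP=> /exists_inP[j]; rewrite Ep !inE => /orP[/eqP -> //|/eqP ->].
        by rewrite (negbTE pr).
      by rewrite !(rank_below_left (@is_left_lt m n)) // left_of -?vE -?wE.
    have right_of i : full is_left (i |: E) -> ~~ is_left i.
      case/andP=> _ /exists_inP[j]; rewrite Ep !inE => /orP[/eqP -> //|/eqP ->].
      by rewrite pl.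
    have rank1 i : ~~ is_left i -> rank_below E i = 1%N.
      by move=> ir; rewrite rank_belowE Ep big_mkcondr big_set1 is_left_lt.
    by rewrite !rank1 // right_of -?vE -?wE.
  rewrite /visscher_inc {1}uv {1}uw !incidenceU1 // vE wE.
  apply/eqP; have := sign_swap int l'E lE; rewrite eq_sym ll' => /(_ isT) /eqP.
  by rewrite -addr_eq0 -rank_eq -mulrDr mulf_eq0 signr_eq0.
- move=> u v w z dim_u dim_v dim_w vw vu wu zv zw.
  have [l lv uv] : exists2 l, l \notin vertices v & vertices u = l |: vertices v.
    by apply: codim1_facet => //; rewrite dim_v.
  have [l' lw uw] : exists2 l, l \notin vertices w & vertices u = l |: vertices w.
    by apply: codim1_facet => //; rewrite dim_w.
  have [i iz vz] := codim1_facet zv dim_v.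
  have [j jz wz] := codim1_facet zw dim_w.
  have ij : i != j.
    by apply: contraNneq vw => ij; apply/eqP/vertices_inj; rewrite vz wz ij.
  have lj : l = j.
    have : j \in vertices u by rewrite uw wz setU1r // setU11.
    by rewrite uv vz !in_setU1 (negbTE jz) [j == i]eq_sym (negbTE ij) !orbF => /eqP.
  have li : l' = i.
    have : i \in vertices u by rewrite uv vz setU1r // setU11.
    by rewrite uw wz !in_setU1 (negbTE iz) (negbTE ij) !orbF => /eqP.
  rewrite /visscher_inc {1}uv {1}uw !incidenceU1 // vz wz !incidenceU1 // lj li.
  rewrite mulrC sign_swap //.
  by rewrite [X in - X + _]mulrC addNr.
Qed.
End VisscherCells.

(** * Labels, the cellular differential and minimality *)

Section VisscherLabels.
Variables (k : fieldType) (m n : nat) (lam : 'I_m + 'I_n -> nat).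
Local Notation N := (m + n)%N.
Local Notation K := (visscher_cells m n).
Local Notation S := {mpoly k[N]}.
Implicit Types (u v : vface m n).

Definition weight (l : 'I_N) : nat := lam (split l).

Lemma weight_l a : weight (lshift n a) = lam (inl a).
Proof. by congr lam; exact: (unsplitK (inl a)). Qed.

Lemma weight_r b : weight (rshift m b) = lam (inr b).
Proof. by congr lam; exact: (unsplitK (inr b)). Qed.

Lemma big_mlcmE (I : finType) (P : pred I) (F : I -> 'X_{1..N}) l :
  (\big[@mlcm N/0%MM]_(i | P i) F i) l = (\max_(i | P i) F i l)%N.
Proof.
by apply: (big_morph (fun mu : 'X_{1..N} => mu l)) => [mu nu|]; rewrite mnmE.
Qed.

Lemma vertex_labelE a b l :
  vertex_label lam a b l = if l \in joint ([set a], [set b]) then weight l else 0%N.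
Proof.
rewrite /vertex_label mnmDE !mulmnE !mnm1E.
case: (split_ordP l) => [i|j] ->; rewrite mem_joint inE.
  rewrite eq_lshift eq_rlshift weight_l mul0n addn0 eq_sym.
  by case: eqP => [->|]; rewrite ?mul1n ?mul0n.
rewrite eq_lrshift eq_rshift weight_r mul0n add0n eq_sym.
by case: eqP => [->|]; rewrite ?mul1n ?mul0n.
Qed.

Lemma face_labelE u : face_label lam (val u) = weight_mnm weight (vertices u).
Proof.
apply/mnmP => l; rewrite big_mlcmE mnmE.
under eq_bigr => a _ do rewrite big_mlcmE.
apply/eqP; rewrite eqn_leq; apply/andP; split.
  apply/bigmax_leqP => a aA; apply/bigmax_leqP => b bB; rewrite vertex_labelE.
  case: ifP => // lab; rewrite ifT //; apply: (fintype.subsetP _ l lab).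
  by rewrite joint_sub !sub1set aA bB.
have /andP[/set0Pn[a0 a0A] /set0Pn[b0 b0B]] := valP u.
have h a b : a \in (val u).1 -> b \in (val u).2 -> l \in joint ([set a], [set b]) ->
  (weight l <= \max_(a in (val u).1) \max_(b in (val u).2) vertex_label lam a b l)%N.
  move=> aA bB lab; apply: leq_trans (leq_bigmax_cond _ aA).
  apply: leq_trans (leq_bigmax_cond _ bB).
  by rewrite vertex_labelE lab.
case: ifP => //; rewrite /vertices; move: h.
case: (split_ordP l) => [i|j] -> h; rewrite mem_joint => ij.
  by apply: (h i b0); rewrite ?mem_joint ?set11.
by apply: (h a0 j); rewrite ?mem_joint ?set11.
Qed.

Lemma vertex_through u l : l \in vertices u ->
  exists v : cells K, [/\ cell_dim v = 0%N, cell_face v u & l \in vertices v].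
Proof.
have /andP[/set0Pn[a0 a0A] /set0Pn[b0 b0B]] := valP u.
have vertex a b : a \in (val u).1 -> b \in (val u).2 -> l \in joint ([set a], [set b]) ->
  exists v : cells K, [/\ cell_dim v = 0%N, cell_face v u & l \in vertices v].
  move=> aA bB lab.
  have [|v vab] := @vertices_surj m n (joint ([set a], [set b])).
    by rewrite full_joint /= -!card_gt0 !cards1.
  exists v; split; last by rewrite vab.
    by rewrite cell_dimE vab card_joint !cards1.
  by rewrite cell_faceE vab joint_sub !sub1set aA bB.
rewrite {1}/vertices; move: vertex.
case: (split_ordP l) => [i|j] -> vertex; rewrite mem_joint => ij.
  by apply: (vertex i b0); rewrite ?mem_joint ?set11.
by apply: (vertex a0 j); rewrite ?mem_joint ?set11.
Qed.

Lemma cell_labelE (u : cells K) :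
  cell_label (visscher_vertex_label lam) u = weight_mnm weight (vertices u).
Proof.
apply/mnmP => l; rewrite /cell_label big_mlcmE mnmE.
apply/eqP; rewrite eqn_leq; apply/andP; split.
  apply/bigmax_leqP => v /andP[_]; rewrite cell_faceE => /fintype.subsetP vu.
  rewrite /visscher_vertex_label face_labelE mnmE; case: ifP => // /vu ->; exact: leqnn.
case: ifP => // /vertex_through[v [v0 vu lv]].
have h : (cell_dim v == 0%N) && cell_face v u by rewrite v0 vu eqxx.
apply: leq_trans (@leq_bigmax_cond _ _ (fun v => visscher_vertex_label lam v l) v h).
by rewrite /visscher_vertex_label face_labelE mnmE lv.
Qed.

Lemma symbol_bdE d (u v : vface m n) (v_dim : cell_dim (v : cells K) == d) :
  (symbol_bd k lam d.+1 (val u) : {ffun dcell K d -> S^o}) (exist _ v v_dim) =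
  (visscher_inc u v)%:~R * 'X_[face_label lam (val u) - face_label lam (val v)].
Proof.
rewrite /symbol_bd !ffunE !sum_ffunE.
rewrite /visscher_inc /incidence rmorph_sum mulr_suml.
rewrite [RHS]big_mkcond big_split_ord /=; congr (_ + _).
  rewrite [LHS]big_mkcond; apply: eq_bigr => a _; rewrite !ffunE.
  rewrite mem_joint rank_below_joint_l -jointD1l (inj_eq (@joint_inj m n)).
  have [aA|] := boolP (a \in (val u).1) => //=.
  have [vE|vE] := eqVneq (val v) _; last by rewrite scaler0 if_same.
  rewrite vE ifT; first by rewrite /GRing.scale /= mulr1 rmorph_sign.
  by rewrite (cardsD1 a) aA ltnS card_gt0; have /andP[] := valP v; rewrite vE.
rewrite [LHS]big_mkcond; apply: eq_bigr => b _; rewrite !ffunE.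
rewrite mem_joint rank_below_joint_r -jointD1r (inj_eq (@joint_inj m n)).
have [bB|] := boolP (b \in (val u).2) => //=.
have [vE|vE] := eqVneq (val v) _; last by rewrite scaler0 if_same.
rewrite vE ifT; first by rewrite /GRing.scale /= mulr1 rmorph_sign.
by rewrite (cardsD1 b) bB ltnS card_gt0; have /andP[] := valP v; rewrite vE.
Qed.

Lemma visscher_bd_cellular d :
  visscher_bd k lam d =1 cellular_bd k (visscher_vertex_label lam) (@visscher_inc m n) d.
Proof.
case: d => [|d] x.
  by apply: eq_bigr => u _; rewrite /= face_labelE -cell_labelE.
apply/ffunP => -[v v_dim]; rewrite [LHS]sum_ffunE !ffunE; apply: eq_bigr => u _.
rewrite ffunE symbol_bdE; congr (_ * (_ * 'X_[_])).
by rewrite !face_labelE -!cell_labelE.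
Qed.

Lemma visscher_cellular_complex (R : realType) : visscher_cellular k lam R.
Proof.
split; first exact: visscher_regular.
exists (@visscher_inc m n); first exact: visscher_incidence_function.
exact: visscher_bd_cellular.
Qed.

Lemma variables_idealX (mu : 'X_{1..N}) l : (1 <= mu l)%N ->
  ('X_[mu] : S) \in variables_ideal (k := k) (N := N).
Proof.
move=> mul; apply/asboolP.
exists (fun i => if i == l then 'X_[mu - U_(l)] else 0).
rewrite (bigD1 l) //= eqxx big1 ?addr0 => [|i /negbTE ->]; last by rewrite scale0r.
rewrite /GRing.scale /= -mpolyXD submK //.
by apply/mnm_lepP => i; rewrite mnm1E; case: eqP => // <-.
Qed.

Lemma variables_idealM (p q : S) : q \in variables_ideal (k := k) (N := N) ->
  p * q \in variables_ideal (k := k) (N := N).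
Proof.
move=> /asboolP[c ->]; apply/asboolP; exists (fun i => p * c i).
by rewrite mulr_sumr; apply: eq_bigr => i _; rewrite -scalerA.
Qed.

Lemma visscher_minimal : (forall z, (1 <= lam z)%N) -> minimal_bd (visscher_bd k lam).
Proof.
move=> lam_gt0; split=> [u|d u w]; rewrite visscher_bd_cellular.
  rewrite /= (bigD1 u) //= big1 ?addr0 => [|v /negbTE vu]; last by rewrite ffunE vu mul0r.
  rewrite ffunE eqxx mul1r cell_labelE.
  have /andP[/exists_inP[a aC _] _] := vertices_full (val u).
  by apply: (variables_idealX (l := a)); rewrite mnmE aC; exact: lam_gt0.
rewrite ffunE (bigD1 u) //= big1 ?addr0 => [|z /negbTE zu]; last by rewrite ffunE zu mul0r.
rewrite ffunE eqxx mul1r.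
have [->|/incidence_neq0[l lv uv]] := eqVneq (visscher_inc (val u) (val w)) 0.
  by rewrite mul0r; have [] := lspan_submod (fun i : 'I_N => 'X_i : S^o).
apply: variables_idealM.
apply: (variables_idealX (l := l)).
by rewrite !cell_labelE mnmBE !mnmE uv setU11 (negbTE lv) subn0; exact: lam_gt0.
Qed.

End VisscherLabels.

(** * Exactness in positive degrees *)

Section VisscherExactness.
Variables (k : fieldType) (m n : nat) (lam : 'I_m + 'I_n -> nat).
Local Notation N := (m + n)%N.
Local Notation K := (visscher_cells m n).
Local Notation S := {mpoly k[N]}.
Local Notation F d := (cell_module k N K d).
Local Notation bd := (visscher_bd k lam).
Local Notation wt := (weight_mnm (weight lam)).
Implicit Types (C E : {set 'I_N}).

(** The coefficient of each symbol is multiplied by its label; the monomial coefficients of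
    the differential, being quotients of labels, disappear. *)
Definition chain d (x : F d.+1) C : S :=
  \sum_(u : dcell K d | vertices (val u) == C)
     (x : {ffun dcell K d -> S^o}) u * 'X_[wt C].

Lemma dcell_card d (u : dcell K d) : #|vertices (val u)| = d.+2.
Proof. by apply/eqP; rewrite -cell_dim_card; exact: (valP u). Qed.

Lemma chain_vertices d (x : F d.+1) (u : dcell K d) :
  chain x (vertices (val u)) =
  (x : {ffun dcell K d -> S^o}) u * 'X_[wt (vertices (val u))].
Proof.
rewrite /chain (big_pred1 u) // => v /=.
by rewrite (inj_eq (@vertices_inj m n)) (inj_eq val_inj).
Qed.

Lemma chain_eq0 d (x : F d.+1) C :
  (forall u : dcell K d, vertices (val u) != C) -> chain x C = 0.
Proof. by move=> h; apply: big1 => u /eqP uC; have := h u; rewrite uC eqxx. Qed.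

Lemma chain_supported d (x : F d.+1) : supported_full is_left (chain x).
Proof.
move=> C Cf; apply: chain_eq0 => u; apply: contraNneq Cf => <-.
exact: vertices_full.
Qed.

Lemma chain_card d (x : F d.+1) C : #|C| != d.+2 -> chain x C = 0.
Proof.
move=> Cd; apply: chain_eq0 => u; apply: contraNneq Cd => <-.
by rewrite dcell_card.
Qed.

Lemma dcell_surj C d : full is_left C -> #|C| = d.+2 ->
  exists u : dcell K d, vertices (val u) = C.
Proof.
move=> /vertices_surj [u uC] Cd.
have ud : cell_dim (u : cells K) == d by rewrite cell_dim_card uC Cd.
by exists (exist _ (u : cells K) ud).
Qed.

Lemma chain_divides d (x : F d.+1) C : mnm_divides (wt C) (chain x C).
Proof. by apply: mnm_divides_sum => u _; exact: mnm_divides_mul. Qed.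

Lemma chain_inj d (x x' : F d.+1) : chain x =1 chain x' -> x = x'.
Proof.
move=> xx'; apply/ffunP => u; have := xx' (vertices (val u)).
by rewrite !chain_vertices => /mulIf; apply; rewrite -msupp_eq0 msuppX.
Qed.

Lemma chain0 d C : chain (0 : F d.+1) C = 0.
Proof. by apply: big1 => u _; rewrite ffunE mul0r. Qed.

(** The families in the image of [chain] are those that the labels divide. *)
Lemma chain_surj d (y : {set 'I_N} -> S) : supported_full is_left y ->
  (forall C, mnm_divides (wt C) (y C)) -> (forall C, #|C| != d.+2 -> y C = 0) ->
  exists x : F d.+1, chain x =1 y.
Proof.
move=> yf ydiv yd.
exists ([ffun u : dcell K d => mnm_quotient (wt (vertices (val u))) (y (vertices (val u)))]
          : {ffun dcell K d -> S^o}) => C.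
have [Cf|/[dup] Cf /yf ->] := boolP (full is_left C); last exact: chain_supported.
have [Cd|/[dup] Cd /yd ->] := eqVneq #|C| d.+2; last exact: chain_card.
have [u <-] := dcell_surj Cf Cd.
by rewrite chain_vertices ffunE mnm_quotientK.
Qed.

Lemma chain_bd d (x : F d.+2) C :
  chain (bd d.+1 x) C = truncated_bd is_left (chain x) C.
Proof.
rewrite /truncated_bd; case: ifP => [Cf|/negbT]; last exact: chain_supported.
have [Cd|Cd] := eqVneq #|C| d.+2; last first.
  rewrite chain_card // /koszul_bd big1 // => l lC.
  by rewrite chain_card ?mulr0 // cardsU1 lC add1n eqSS.
have [v <-] := dcell_surj Cf Cd.
rewrite chain_vertices visscher_bd_cellular ffunE mulr_suml incidence_bd.
rewrite (partition_big (fun u : dcell K d.+1 => vertices (val u)) xpredT) //=.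
apply: eq_bigr => E _; rewrite /chain mulr_sumr; apply: eq_bigr => u /eqP <-.
rewrite !cell_labelE /visscher_inc.
have [->|/incidence_neq0[l lv ->]] :=
  eqVneq (incidence (vertices (val u)) (vertices (val v))) 0.
  by rewrite mul0r mulr0 !mul0r.
rewrite mulrCA -!mulrA -mpolyXD submK //.
by apply/weight_mnm_leP => i iv; rewrite mnmE setU1r.
Qed.

Lemma incidence_edge E : full is_left E -> #|E| = 2 ->
  \sum_(b | ~~ is_left b) incidence E [set b] = 1.
Proof.
move=> /andP[/exists_inP[a aE la] /exists_inP[b bE rb]] E2.
have ab : a != b by apply: contraNneq rb => <-.
have EE : E = a |: [set b].
  apply/esym/eqP; rewrite finset.eqEcard finset.subUset !sub1set aE bE /=.
  by rewrite cards2 ab E2.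
rewrite (bigD1 b) //= big1 ?addr0.
  rewrite EE incidenceU1 ?inE //; rewrite (rank_below_left (@is_left_lt m n)) //.
  by apply/forall_inP => i /set1P ->.
move=> i /andP[ri ib]; apply/eqP/negPn/negP => /incidence_neq0[l li iE].
have : i \in E by rewrite iE !inE eqxx orbT.
rewrite EE !inE (negbTE ib) orbF => /eqP ia.
by rewrite ia la in ri.
Qed.

(** An edge {a, b} of the graph enters the augmentation once, at its right end, with sign 1. *)
Lemma chain_bd0 (x : F 1) : bd 0 x = augmentation is_left (chain x).
Proof.
rewrite /augmentation; under eq_bigr => b _ do rewrite incidence_bd.
rewrite exchange_big visscher_bd_cellular /=.
rewrite (partition_big (fun u : dcell K 0 => vertices (val u)) xpredT) //=.
apply: eq_bigr => E _; rewrite -mulr_suml -rmorph_sum /=.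
have [Ef|/[dup] Ef /(chain_supported x) xE] := boolP (full is_left E); last first.
  rewrite xE mulr0 big1 // => u /eqP uE.
  by case/negP: Ef; rewrite -uE vertices_full.
have [E2|/[dup] E2 /(chain_card x) xE] := eqVneq #|E| 2; last first.
  by rewrite xE mulr0 big1 // => u /eqP uE; rewrite -uE dcell_card in E2.
rewrite incidence_edge // mul1r; apply: eq_bigr => u /eqP <-.
by rewrite cell_labelE.
Qed.

(** Exactness of the simplicial complex of divisible chains, transported along [chain].
    In the lowest degree being a cycle means that the augmentation vanishes; in higher
    degrees the augmentation vanishes for reasons of cardinality. *)
Lemma visscher_exact d (x : F d.+1) : bd d x = 0 <-> exists y : F d.+2, x = bd d.+1 y.
Proof.
split=> [|[y ->]].
  move=> bdx.
  have x_cycle C : full is_left C -> koszul_bd (chain x) C = 0.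
    move=> Cf; case: d x bdx => [|d] x bdx.
      apply: big1 => l lC; rewrite chain_card ?mulr0 // cardsU1 lC add1n eqSS.
      have [u <-] := vertices_surj Cf.
      have := vertices_card_ge2 u; lia.
    by have := chain_bd x C; rewrite bdx chain0 /truncated_bd Cf.
  have x_aug : augmentation is_left (chain x) = 0.
    case: d x bdx x_cycle => [|d] x bdx x_cycle; first by rewrite -chain_bd0.
    apply: big1 => b _; apply: big1 => l lb.
    by rewrite chain_card ?mulr0 // cardsU1 lb cards1.
  have [y [y_full y_div y_card y_bd]] := divisible_chain_exact
    (chain_supported x) (@chain_divides d x) (@chain_card d x) x_cycle x_aug.
  have [y' y'E] := chain_surj y_full y_div y_card.
  exists y'; apply: chain_inj => C; rewrite chain_bd (funext y'E) /truncated_bd.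
  by case: ifP => [/y_bd //|/negbT /(chain_supported x)].
case: d x y => [|d] _ y.
  by rewrite chain_bd0 (funext (chain_bd y)) augmentation_truncated_bd.
apply: chain_inj => C; rewrite chain_bd (funext (chain_bd y)) chain0 {1}/truncated_bd.
by case: ifP => // Cf; rewrite truncated_bdK.
Qed.

End VisscherExactness.

(** * Free terms and the cokernel *)

Section QuotientIso.
Variables (A : comNzRingType) (M : lmodType A) (N1 N2 : submodClosed M).
Hypothesis eqN : forall x, (x \in N1) = (x \in N2).

Definition quotmod_transfer (q : quotmod N1) : quotmod N2 :=
  quotmod_pi N2 (repr (q : Quotient.quot (submod_pred N1))).

Lemma quotmod_transferE x : quotmod_transfer (quotmod_pi N1 x) = quotmod_pi N2 x.
Proof. by apply/eqP; rewrite quotmod_piP -eqN -quotmod_piP quotmod_piK. Qed.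

Lemma quotmod_transfer_linear : linear quotmod_transfer.
Proof.
move=> a p q; rewrite -[p]quotmod_piK -[q]quotmod_piK !quotmod_transferE.
rewrite /GRing.scale /= !quotmod_scaleE -!quotmod_piD.
by rewrite quotmod_transferE.
Qed.

HB.instance Definition _ := GRing.isLinear.Build A (quotmod N1) (quotmod N2)
  *:%R quotmod_transfer quotmod_transfer_linear.

(** Two submodules with the same elements may differ as terms, and then so do the quotients. *)
Lemma quotmod_iso : lmod_iso (quotmod N1) (quotmod N2).
Proof.
exists quotmod_transfer.
exists (fun q : quotmod N2 => quotmod_pi N1 (repr (q : Quotient.quot (submod_pred N2)))) => q.
  rewrite -[RHS]quotmod_piK; apply/eqP.
  by rewrite quotmod_piP eqN -quotmod_piP quotmod_piK.
rewrite -[RHS]quotmod_piK; exact: quotmod_transferE.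
Qed.

End QuotientIso.

Lemma finite_free_ffun (A : comNzRingType) (I : finType) :
  finite_free ({ffun I -> A^o} : lmodType A).
Proof. by exists I, idfun; exists idfun. Qed.

Section RankOne.
Variable A : comNzRingType.

Definition ffun_unit_val (f : {ffun unit -> A^o}) : A^o := f tt.

Lemma ffun_unit_val_linear : linear ffun_unit_val.
Proof. by move=> a f g; rewrite /ffun_unit_val !ffunE. Qed.

HB.instance Definition _ := GRing.isLinear.Build A {ffun unit -> A^o} A^o
  *:%R ffun_unit_val ffun_unit_val_linear.

Lemma finite_free_regular : finite_free (A^o : lmodType A).
Proof.
exists unit, ffun_unit_val; exists (fun a => [ffun=> a]) => [f|a].
  by apply/ffunP => -[]; rewrite ffunE.
by rewrite /= /ffun_unit_val ffunE.
Qed.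

End RankOne.

Section VisscherResolution.
Variables (k : fieldType) (m n : nat) (lam : 'I_m + 'I_n -> nat).
Local Notation K := (visscher_cells m n).
Local Notation S := {mpoly k[m + n]}.

Lemma edge_generatorE a b :
  edge_generator k lam (a, b) = 'X_[weight_mnm (weight lam) (joint ([set a], [set b]))].
Proof.
rewrite /edge_generator !mpolyXn -mpolyXD; congr mpolyX.
by apply/mnmP => l; rewrite [RHS]mnmE -vertex_labelE.
Qed.

(** The cells of dimension 0 are the edges of the graph, and their labels are the generators
    of the edge ideal. *)
Lemma limage_edge_ideal (p : S^o) :
  (p \in limage (visscher_bd k lam 0)) = (p \in edge_ideal k lam).
Proof.
apply/idP/idP => [/asboolP[x ->]|/asboolP[c ->]].
  rewrite visscher_bd_cellular /=; apply: rpred_sum => u _.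
  apply: (rpredZ (x u : S)); apply/asboolP.
  have := dcell_card u; have /andP[] := valP (val u).
  rewrite cell_labelE /vertices card_joint; case: (val (val u)) => A B /=.
  rewrite -!card_gt0 => A0 B0 AB.
  have /cards1P[a ->] : #|A| == 1%N.
    by move: A0 B0 AB; case: #|A| => [|[|i]] //; case: #|B| => // j _ _; rewrite addnS.
  have /cards1P[b ->] : #|B| == 1%N.
    by move: A0 B0 AB; case: #|B| => [|[|j]] //; case: #|A| => // i _ _; rewrite !addnS.
  exists (fun e => (e == (a, b))%:R); rewrite -edge_generatorE.
  rewrite (bigD1 (a, b)) //= big1 ?addr0 => [|e /negbTE ->]; last by rewrite scale0r.
  by rewrite eqxx scale1r.
apply: rpred_sum => -[a b] _; apply: rpredZ; rewrite edge_generatorE.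
have abf : full is_left (joint ([set a], [set b])).
  by rewrite full_joint /= -!card_gt0 !cards1.
have [|u uE] := dcell_surj abf (d := 0); first by rewrite card_joint !cards1.
apply/asboolP; exists ([ffun v => (v == u)%:R] : {ffun dcell K 0 -> S^o}).
rewrite visscher_bd_cellular /= (bigD1 u) //= big1 ?addr0 => [|v /negbTE vu].
  by rewrite ffunE eqxx mul1r cell_labelE uE.
by rewrite ffunE vu mul0r.
Qed.

Lemma visscher_free_resolution :
  free_resolution (visscher_complex k lam) (quotmod (edge_ideal k lam)).
Proof.
split.
- case=> [|d]; first exact: finite_free_regular.
  exact: finite_free_ffun.
- exact: visscher_exact.
- by apply: quotmod_iso; exact: limage_edge_ideal.
Qed.
End VisscherResolution.

Theorem proposition2p8 (R : realType) (k : fieldType) (m n : nat)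
    (hm : (1 <= m)%N) (hn : (1 <= n)%N)
    (lam : 'I_m + 'I_n -> nat) (hlam : forall v, (1 <= lam v)%N) :
  [/\ free_resolution (visscher_complex k lam) (quotmod (edge_ideal k lam)),
      visscher_cellular k lam R
    & minimal_bd (visscher_bd k lam)].
Proof.
split.
- exact: visscher_free_resolution.
- exact: visscher_cellular_complex.
- exact: visscher_minimal.
Qed.
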